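(* For each $r<0$ let $P_r(z,\zeta)$ be a Borel function on $D_r\times S_r$ and let $P(z,\zeta)$ be a Borel function on $D\times\partial D$. Suppose that for each $z\in D$ the functions $P_r(z,\cdot)$ are non-negative and uniformly bounded on $S_r$ for $r$ close to $0$, and that $P(z,\cdot)$ is the weak limit values of $\{P_{r_j}(z,\cdot)\}$ with respect to $\{\mu_{r_j}\}$ for some sequence $r_j\nearrow0$. Let $u$ be a continuous function on $D$ such that: (1) for all $r<0$ and $z\in D_r$, $$u(z)=\int_{S_r}u(\zeta)P_r(z,\zeta)\,d\mu_r(\zeta)+L_r(z,u)$$ for some real numbers $L_r(z,u)$; (2) $\|u\|_p<\infty$ for some $p>1$; (3) $u$ has boundary values $u^*$. If $L_r(z,u)\le0$ and $L(z,u)=\lim_{r\to0^-}L_r(z,u)$ exists for all $z\in D$, then for all $z\in D$ $$u(z)=\int_{\partial D}u^*(\zeta)P(z,\zeta)\,d\mu(\zeta)+L(z,u).$$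
   Context: Standing setting: $D$ is a bounded domain in $\mathbb R^n$ exhausted by domains $D_r$, $r<0$, with $D_r\Subset D_s$ for $r<s<0$ and $\bigcup_{r<0}D_r=D$; $S_r=\partial D_r$. For each $r<0$, $\mu_r$ is a finite positive regular Borel measure supported on $S_r$, and $\mu_r\to\mu$ weak-* in $C(\overline D)^*$ as $r\to0^-$, where $\mu$ is a finite positive measure supported on $\partial D$; $K_0=\operatorname{supp}\mu$. For a sequence $r_j\nearrow0$ and functions $\phi_j$ on $\operatorname{supp}\mu_{r_j}$: $\{\phi_j\}$ has weak limit values $\phi_*$ (a $\mu$-integrable function on $K_0$) if $\int h\phi_j\,d\mu_{r_j}\to\int_{K_0}h\phi_*\,d\mu$ for all $h\in C(\overline D)$; $\{\phi_j\}$ has strong limit values $\phi^*$ (a real $\mu$-measurable function on $K_0$) if for all real $a<b$ and $\varepsilon,\delta>0$ there are $j_0$ and an open set $O\subset\overline D$ containing $\{x\in K_0:a\le\phi^*(x)<b\}$ with $\mu_{r_j}(\{\phi_j<a-\varepsilon\}\cap O)+\mu_{r_j}(\{\phi_j>b+\varepsilon\}\cap O)<\delta$ for $j\ge j_0$. A function $u$ on $D$ has boundary values $u^*$ if for every sequence $r_j\nearrow0$ the sequence $\{u|_{\operatorname{supp}\mu_{r_j}}\}$ has strong limit values with respect to $\{\mu_{r_j}\}$, equal to $u^*$ ($\mu$-a.e.) independently of the sequence. $\|u\|_p=\limsup_{r\to0^-}\int_{S_r}|u|^p\,d\mu_r$. *)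

(* Defs.v *)
From HB Require Import structures.
From mathcomp Require Import all_boot all_order all_algebra.
From mathcomp Require Import all_classical all_reals all_analysis.
Set Implicit Arguments. Unset Strict Implicit. Unset Printing Implicit Defensive.
Import Order.TTheory GRing.Theory Num.Theory.
Import numFieldNormedType.Exports.
Local Open Scope classical_set_scope.
Local Open Scope ring_scope.

Definition borelRn (R : realType) (n : nat) :=
  g_sigma_algebraType (@open 'rV[R]_n).

Section defs.
Context {R : realType} {n : nat}.
Local Notation E := 'rV[R]_n.
Local Notation B := (borelRn R n).

Definition domain (A : set E) := [/\ open A, connected A & A !=set0].

Definition bdry (A : set E) : set E := closure A `\` interior A.

Definition msupp (m : {measure set B -> \bar R}) : set E :=
  [set x | forall e : R, 0 < e -> (0 < m (ball x e))%E].

Definition incr_to_0 (rj : nat -> R) :=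
  [/\ (forall j, rj j < 0), {homo rj : i j / (i < j)%N >-> i < j}
    & rj @ \oo --> 0].

(** f is mu-measurable on K (measurable for the completion of mu):
    f coincides mu-a.e. on K with a Borel function *)
Definition mu_measurable_on (m : {measure set B -> \bar R}) (K : set E)
  (f : E -> R) :=
  exists g : B -> R, measurable_fun (K : set B) g /\ f = g %[ae m in K].

Definition mu_integrable_on (m : {measure set B -> \bar R}) (K : set E)
  (f : E -> R) :=
  mu_measurable_on m K f /\ (\int[m]_(x in K) `|f x|%:E < +oo)%E.

Variables (D : set E) (mu_r : R -> {measure set B -> \bar R})
  (mu : {measure set B -> \bar R}).

Definition weak_limit_values (rj : nat -> R) (phi : nat -> E -> R)
  (phis : E -> R) :=
  mu_integrable_on mu (msupp mu) phis /\
  forall h : E -> R, {within closure D, continuous h} ->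
    (fun j => \int[mu_r (rj j)]_(x in closure D) (h x * phi j x))
      @ \oo --> \int[mu]_(x in msupp mu) (h x * phis x).

(** strong limit values phis of {phi j} w.r.t. {mu_(r_j)}; the open
    subsets of closure D are the traces U `&` closure D of open sets U *)
Definition strong_limit_values (rj : nat -> R) (phi : nat -> E -> R)
  (phis : E -> R) :=
  mu_measurable_on mu (msupp mu) phis /\
  forall a b eps delta : R, a < b -> 0 < eps -> 0 < delta ->
    exists j0 : nat, exists U : set E,
      open U /\
      [set x | msupp mu x /\ a <= phis x < b] `<=` U `&` closure D /\
      forall j, (j0 <= j)%N ->
        (mu_r (rj j) ([set x | msupp (mu_r (rj j)) x /\ (phi j x < a - eps)%R]
                       `&` (U `&` closure D))
         + mu_r (rj j) ([set x | msupp (mu_r (rj j)) x /\ (b + eps < phi j x)%R]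
                       `&` (U `&` closure D)) < delta%:E)%E.

Definition has_boundary_values (u us : E -> R) :=
  mu_measurable_on mu (msupp mu) us /\
  forall rj : nat -> R, incr_to_0 rj ->
    exists phis : E -> R,
      strong_limit_values rj (fun _ => u) phis /\
      phis = us %[ae mu in msupp mu].

Definition pnorm (S : R -> set E) (p : R) (u : E -> R) : \bar R :=
  limf_esup (fun r => (\int[mu_r r]_(x in S r) (`|u x| `^ p)%:E)%E) (0^'-).

End defs.

Definition standing_setting {R : realType} {n : nat} (D : set 'rV[R]_n)
  (Dr : R -> set 'rV[R]_n) (mu_r : R -> {measure set borelRn R n -> \bar R})
  (mu : {measure set borelRn R n -> \bar R}) :=
  domain D /\ bounded_set D /\
  (forall r, r < 0 -> domain (Dr r)) /\
  (forall r s, r < s -> s < 0 ->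
     compact (closure (Dr r)) /\ closure (Dr r) `<=` Dr s) /\
  \bigcup_(r in [set r : R | r < 0]) Dr r = D /\
  (forall r, r < 0 ->
     (mu_r r setT < +oo)%E /\ msupp (mu_r r) `<=` bdry (Dr r)) /\
  (mu setT < +oo)%E /\ msupp mu `<=` bdry D /\
  (forall h : 'rV[R]_n -> R, {within closure D, continuous h} ->
     (fun r => \int[mu_r r]_(x in closure D) h x) @ 0^'-
       --> \int[mu]_(x in closure D) h x).

(* Main.v *)
Require Import Defs.
From HB Require Import structures.
From mathcomp Require Import all_boot all_order all_algebra.
From mathcomp Require Import all_classical all_reals all_analysis.
From mathcomp Require Import measurable_realfun ring lra.
Import Order.TTheory GRing.Theory Num.Theory.
Import numFieldNormedType.Exports.
Local Open Scope classical_set_scope.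
Local Open Scope ring_scope.
Set Implicit Arguments. Unset Strict Implicit. Unset Printing Implicit Defensive.

(** Fix z and let phi_j = P_{r_j}(z, .), phi = P(z, .). By the representation
formula it is enough that the integrals of u phi_j against mu_{r_j} converge to
the integral of u^* phi against mu. Borel sets can be approximated in
L^1(|phi| mu) by continuous functions supported in a prescribed open
neighbourhood, so weak convergence of phi_j and strong convergence of u give,
for every level a, that the phi_j mu_{r_j}-mass of {u >= a - eta} is
asymptotically at least the phi mu-mass of {u^* >= a} truncated above. Summing
over levels yields a Fatou inequality for the positive part of u + N. Since
(u + N)^+ exceeds u + N by at most N^(1-p) |u|^p, the bound on the p-th moments
turns this, as N tends to infinity, into the inequality "integral of u^* phi
at most the limit"; the same inequality for - u is the converse one. *)

(** No dominated convergence argument combines the two modes of convergence: the measures change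
    with j, and strong convergence only says that, near a slice a <= u^* < b, the points violating
    these bounds carry little mass. The mass therefore has to be localised near the slice first, and
    the bound phi_j <= M then turns a small mu_{r_j}-mass of violating points into a small phi_j
    mu_{r_j}-mass. The shift by N is there because a Fatou inequality concerns non-negative
    functions, while u has no lower bound. Integrability of u^* phi is itself to be proved: it
    follows from the Fatou inequalities for the positive parts of u^* and - u^*. Measurability and
    sign conditions are not given on the whole space, and partly hold only almost everywhere; so
    functions are extended by zero and a null set is removed from K_0, after which phi >= 0
    everywhere and the strong limit agrees with a Borel function at every remaining point. *)

(** * Integrals of functions that agree off a null set *)

Section conull.
Context d (T : measurableType d) (R : realType).
Variable m : {measure set T -> \bar R}.
Import HBNNSimple.
Local Open Scope ereal_scope.

(* The integrands are not assumed measurable: the hypotheses of the theorem say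
   nothing about them off the supports of the measures. *)
Let ge0_le_integral_off_null (N : set T) (f g : T -> \bar R) :
  measurable N -> m N = 0 -> (forall x, 0 <= f x) -> (forall x, 0 <= g x) ->
  (forall x, ~ N x -> f x = g x) -> \int[m]_x f x <= \int[m]_x g x.
Proof.
move=> mN N0 f0 g0 fg; rewrite ge0_integralTE// ge0_integralTE//.
apply: ge_ereal_sup => _ [h /= hf <-].
(* A simple function below [f], set to zero on [N], keeps its integral and lies below [g], because
   [g] is non-negative on [N]. *)
pose h' := proj_nnsfun h (measurableC mN).
have -> : sintegral m h = sintegral m h'.
  rewrite -!integralT_nnsfun; apply: ae_eq_integral => //; last first.
  - exists N; split => // x /= hx; apply: contrapT => Nx; apply: hx => _ /=.
    by rewrite mindicE mem_set//= mulr1.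
  - exact/measurable_EFinP.
  - exact/measurable_EFinP.
apply: ereal_sup_ubound; exists h' => //= x; rewrite mindicE.
have [/set_mem xN|] := boolP (x \in ~` N); first by rewrite mulr1 -fg.
by rewrite mulr0.
Qed.

Lemma eq_integral_off_null (N D1 D2 : set T) (f g : T -> \bar R) :
  measurable N -> m N = 0 ->
  (forall x, ~ N x -> (f \_ D1) x = (g \_ D2) x) ->
  \int[m]_(x in D1) f x = \int[m]_(x in D2) g x.
Proof.
move=> mN N0 fg; rewrite (integral_mkcond D1) (integral_mkcond D2).
rewrite [LHS]integralE [RHS]integralE.
have fgp x : ~ N x -> (f \_ D1)^\+ x = (g \_ D2)^\+ x.
  by move=> /fg fgx; rewrite !funeposE fgx.
have fgn x : ~ N x -> (f \_ D1)^\- x = (g \_ D2)^\- x.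
  by move=> /fg fgx; rewrite !funenegE fgx.
by congr (_ - _); apply/le_anti/andP; split;
  apply: (ge0_le_integral_off_null mN N0) => // x Nx; rewrite ?fgp ?fgn.
Qed.

End conull.

(** For approximating unions: the indicator of a union is the maximum of the indicators. *)
Lemma distr_max_le (R : realDomainType) (a b c d : R) :
  `|Num.max a b - Num.max c d| <= `|a - c| + `|b - d|.
Proof.
have := ler_norm (a - c); have := ler_norm (b - d).
have := ler_norm (c - a); have := ler_norm (d - b).
rewrite (distrC c) (distrC d) => ? ? ? ?; rewrite ler_norml.
by case: (leP a b) => ?; case: (leP c d) => ?; apply/andP; split; lra.
Qed.

(** * Continuous approximation of Borel sets in a weighted L^1 space *)

Section approx.
Context {R : realType} {n : nat}.
Local Notation E := 'rV[R]_n.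
Local Notation B := (borelRn R n).

Lemma open_measurableRn (U : set E) : open U -> measurable (U : set B).
Proof. by move=> oU; exact: sub_sigma_algebra. Qed.

Lemma closed_measurableRn (U : set E) : closed U -> measurable (U : set B).
Proof.
move=> cU; rewrite -[U]setCK; apply: measurableC; apply: open_measurableRn.
exact: closed_openC.
Qed.

(** Meant for [u], which is continuous only on the domain: preimages of open intervals are open once
    intersected with [U]. *)
Lemma measurable_fun_openRn (D U : set E) (f : E -> R) :
  measurable (D : set B) -> open U -> D `<=` U ->
  (forall x, U x -> {for x, continuous f}) ->
  measurable_fun (D : set B) (f : B -> R).
Proof.
move=> mD oU DU cf; apply: (measurability _ (RGenOpens.measurableE R)).
move=> _ [_ [a [b ->] <-]].
rewrite (_ : _ `&` _ = D `&` (U `&` f @^-1` `]a, b[%classic)); last first.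
  by apply/seteqP; split => x /= [Dx]; [move=> ?; do ! split => //; exact: DU|case].
apply: measurableI => //; apply: open_measurableRn.
rewrite openE => x [Ux fx]; rewrite /interior.
apply: filterI; first exact: open_nbhs_nbhs.
by apply: (cf x Ux); apply: open_nbhs_nbhs; split => //; exact: interval_open.
Qed.

Lemma continuous_measurable_funRn (f : E -> R) :
  continuous f -> measurable_fun setT (f : B -> R).
Proof.
move=> cf; apply: (@measurable_fun_openRn setT setT) => //.
  exact: openT.
by move=> x _; exact: cf.
Qed.

Variables (mu : {measure set B -> \bar R}) (w : B -> R).
Hypothesis iw : mu.-integrable setT (EFin \o w).

Lemma integrable_bounded_mul (c : R) (f : B -> R) : measurable_fun setT f ->
  (forall x, `|f x| <= c) -> mu.-integrable setT (EFin \o (fun x => f x * w x)).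
Proof.
move=> mf fc.
have mw : measurable_fun setT w by apply/measurable_EFinP; exact: measurable_int iw.
apply: (@le_integrable _ _ _ _ _ measurableT _ (fun x => (c * w x)%:E)).
- by apply/measurable_EFinP; exact: measurable_funM.
- move=> x _; rewrite !lee_fin !normrM ler_wpM2r//.
  by rewrite (le_trans (fc x))// ler_norm.
- have := integrableZl measurableT c iw; apply: eq_integrable => // x _ /=.
Qed.

(** The distance of L^1(|w| mu). The weight is taken in absolute value because the approximation is
    first applied to a limit density whose sign is still unknown. *)
Definition l1dist (f g : B -> R) : R := \int[mu]_x (`|f x - g x| * `|w x|).

Definition unit_valued (f : B -> R) := forall x, 0 <= f x <= 1.

Lemma unit_valued_indic A : unit_valued \1_A.
Proof. by move=> x; rewrite indicE; case: (_ \in _); rewrite /= ?lexx ?ler01. Qed.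

Lemma integrable_l1dist f g : measurable_fun setT f -> measurable_fun setT g ->
  unit_valued f -> unit_valued g ->
  mu.-integrable setT (EFin \o (fun x => `|f x - g x| * `|w x|)).
Proof.
move=> mf mg f01 g01.
have := @integrable_bounded_mul 1 (fun x => `|f x - g x|).
move=> /(_ _ _)/integrable_abse H.
apply: eq_integrable (H _ _) => //.
- by move=> x _ /=; rewrite normrM normr_id.
- by apply: measurableT_comp => //; exact: measurable_funB.
- by move=> x; rewrite normr_id; have /andP[? ?] := f01 x; have /andP[? ?] := g01 x;
    rewrite ler_norml; apply/andP; split; lra.
Qed.

Lemma l1dist_sub f g f1 g1 f2 g2 :
  measurable_fun setT f -> measurable_fun setT g ->
  measurable_fun setT f1 -> measurable_fun setT g1 ->
  measurable_fun setT f2 -> measurable_fun setT g2 ->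
  unit_valued f -> unit_valued g ->
  unit_valued f1 -> unit_valued g1 -> unit_valued f2 -> unit_valued g2 ->
  (forall x, `|f x - g x| <= `|f1 x - g1 x| + `|f2 x - g2 x|) ->
  l1dist f g <= l1dist f1 g1 + l1dist f2 g2.
Proof.
move=> *; rewrite /l1dist -RintegralD//; last 2 first.
  exact: integrable_l1dist.
  exact: integrable_l1dist.
apply: le_Rintegral => //; first exact: integrable_l1dist.
  have := @integrableD _ _ _ mu setT measurableT _ _
    (@integrable_l1dist f1 g1 _ _ _ _) (@integrable_l1dist f2 g2 _ _ _ _).
  by apply.
by move=> x _; rewrite -mulrDl ler_wpM2r.
Qed.

(** Dominated convergence: differences of functions with values in [0, 1] are at most 1, so [|w|]
    dominates. *)
Lemma l1dist_cvg0 (fn : nat -> B -> R) f :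
  (forall k, measurable_fun setT (fn k)) -> measurable_fun setT f ->
  (forall k, unit_valued (fn k)) -> unit_valued f ->
  (forall x, fn ^~ x @ \oo --> f x) ->
  forall e, 0 < e -> exists k, l1dist (fn k) f <= e.
Proof.
move=> mfn mf fn01 f01 cf e e0.
have mw : measurable_fun setT w by apply/measurable_EFinP; exact: measurable_int iw.
have [] := @dominated_convergence _ _ _ mu setT measurableT
  (fun k x => (`|fn k x - f x| * `|w x|)%:E) (cst 0%E) (fun x => `|w x|%:E).
- move=> k; apply/measurable_EFinP; apply: measurable_funM.
    by apply: measurableT_comp => //; exact: measurable_funB.
  exact: measurableT_comp.
- exact: measurable_cst.
- apply: aeW => x _; apply/fine_cvgP; split; first exact: nearW.
  rewrite [X in _ --> X](_ : _ = `|f x - f x| * `|w x|); last first.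
    by rewrite subrr normr0 mul0r.
  apply: (@cvgM R _ \oo) => //; last exact: cvg_cst.
  by apply: cvg_norm; apply: cvgB; [exact: cf|exact: cvg_cst].
- exact: integrable_abse iw.
- apply: aeW => x k _; rewrite lee_fin normrM !normr_id ler_piMl//.
  have /andP[? ?] := fn01 k x; have /andP[? ?] := f01 x.
  by rewrite ler_norml; apply/andP; split; lra.
move=> _ _; rewrite integral0 => /fine_cvgP[_ /cvgrPdist_le/(_ _ e0)[k _ /(_ k (leqnn k))]].
rewrite sub0r normrN => H; exists k; apply: le_trans H; exact: ler_norm.
Qed.

Definition l1_approximable (A : set B) := measurable A /\ forall e : R, 0 < e ->
  exists h : E -> R, [/\ continuous h, unit_valued h & l1dist h \1_A <= e].

(** [h k] is a Urysohn function that is 0 off [U] and 1 at distance at least 1/(k+1) from the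
    complement; each point of [U] is eventually that far inside. The extended distance covers the
    case of an empty complement, where it is infinite. *)
Lemma urysohn_inner (U : set E) : open U -> exists h : nat -> E -> R,
  [/\ (forall k, continuous (h k)), (forall k, unit_valued (h k)),
   (forall k x, ~ U x -> h k x = 0) &
   forall x, h ^~ x @ \oo --> (\1_U x : R)].
Proof.
move=> oU.
have /choice[h hP] : forall k : nat, exists f : E -> R, [/\ continuous f,
   unit_valued f, (forall x, ~ U x -> f x = 0) &
   forall x, (k.+1%:R^-1%:E <= edist_inf (~` U) x)%E -> f x = 1].
  move=> k.
  have [|||||f [cf f0 f1 f01]] := @urysohn_ext_itv E R _ (~` U)
    [set x | (k.+1%:R^-1%:E <= edist_inf (~` U) x)%E] 0 1.
  - exact: pseudometric_normal.
  - exact: open_closedC.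
  - rewrite (_ : mkset _ = edist_inf (~` U) @^-1` [set y | (k.+1%:R^-1%:E <= y)%E])//.
    apply: (closed_comp (fun x _ => @edist_inf_continuous R E (~` U) x)).
    exact: closed_ereal_le_ereal.
  - apply/seteqP; split => // x [/= Ux]; rewrite edist_inf0//.
    by rewrite lee_fin leNgt invr_gt0 ltr0n.
  - exact: ltr01.
  exists f; split => //.
  - by move=> x; have := f01 (f x) (ex_intro2 _ _ x I erefl); rewrite /= in_itv.
  - by move=> x Ux; apply: f0; exists x.
  - by move=> x Ux; apply: f1; exists x.
exists h; split=> [k|k|k|x]; [by have [] := hP k|by have [] := hP k|by have [] := hP k|].
rewrite indicE; have [/set_mem Ux|/negP Ux] := boolP (x \in U); last first.
  apply: cvg_near_cst; apply: nearW => k; have [_ _ -> //] := hP k.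
  by move=> Ux'; apply: Ux; exact/mem_set.
apply: cvg_near_cst.
have [r /= r0 rU] : exists2 r : R, 0 < r & (r%:E <= edist_inf (~` U) x)%E.
  have /nbhs_ballP[r /= r0 rU] := open_nbhs_nbhs (conj oU Ux).
  exists r => //; apply: le_ereal_inf_tmp => _ [y Uy <-].
  rewrite leNgt; apply/negP => /edist_lt_ball; exact/contra_not/Uy/rU.
near=> k; have [_ _ _ -> //] := hP k; apply: le_trans rU.
rewrite lee_fin; apply: ltW; near: k; exact: near_infty_natSinv_lt (PosNum r0).
Unshelve. all: by end_near. Qed.

Lemma l1_approximable_open (U : set E) : open U -> l1_approximable U.
Proof.
move=> oU; have mU := open_measurableRn oU; split=> // e e0.
have [h [ch h01 _ hU]] := urysohn_inner oU.
have [|||||k hk] := @l1dist_cvg0 h \1_U _ _ _ _ _ e e0.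
- by move=> k; exact: continuous_measurable_funRn.
- exact: measurable_indic.
- exact: h01.
- exact: unit_valued_indic.
- exact: hU.
by exists (h k).
Qed.

Lemma l1_approximable0 : l1_approximable set0.
Proof. by apply: l1_approximable_open; exact: open0. Qed.

Lemma l1_approximableC A : l1_approximable A -> l1_approximable (~` A).
Proof.
move=> [mA apA]; split; first exact: measurableC.
move=> e e0; have [h [ch h01 hA]] := apA e e0.
exists (fun x => 1 - h x); split.
- by move=> x; apply: (@continuousB R R^o E (cst 1) h); [exact: cst_continuous|exact: ch].
- by move=> x; have /andP[? ?] := h01 x; apply/andP; split; lra.
- apply: le_trans hA; rewrite le_eqVlt; apply/orP; left; apply/eqP.
  apply: eq_Rintegral => x _; congr (_ * _); rewrite distrC; congr (`|_|).
  by rewrite !indicE in_setC; case: (x \in A) => /=; lra.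
Qed.

Lemma l1_approximableU A1 A2 : l1_approximable A1 -> l1_approximable A2 ->
  l1_approximable (A1 `|` A2).
Proof.
move=> [mA1 apA1] [mA2 apA2]; split; first exact: measurableU.
move=> e e0; have e20 : 0 < e / 2 by rewrite divr_gt0.
have [h1 [ch1 h101 hA1]] := apA1 _ e20; have [h2 [ch2 h201 hA2]] := apA2 _ e20.
have mh1 := continuous_measurable_funRn ch1.
have mh2 := continuous_measurable_funRn ch2.
exists (fun x => Num.max (h1 x) (h2 x)); split.
- by move=> x; apply: continuous_max; [exact: ch1|exact: ch2].
- move=> x; have /andP[? ?] := h101 x; have /andP[? ?] := h201 x.
  by case: (leP (h1 x) (h2 x)) => _; apply/andP.
- rewrite [leRHS]splitr; apply: le_trans (lerD hA1 hA2); apply: l1dist_sub => //.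
  + exact: measurable_maxr.
  + by apply: measurable_indic; exact: measurableU.
  + move=> x; have /andP[? ?] := h101 x; have /andP[? ?] := h201 x.
    by case: (leP (h1 x) (h2 x)) => _; apply/andP.
  + exact: unit_valued_indic.
  + exact: unit_valued_indic.
  + exact: unit_valued_indic.
  + move=> x; rewrite (_ : \1_(A1 `|` A2) x = Num.max (\1_A1 x) (\1_A2 x))//.
      exact: distr_max_le.
    rewrite !indicE in_setU.
    by case: (x \in A1); case: (x \in A2); rewrite /= ?maxxx ?(max_l ler01) ?(max_r ler01).
Qed.

(** The finite partial unions are approximable and converge to the whole union in L^1(|w| mu); each
    of the two errors gets [e / 2]. *)
Lemma l1_approximable_bigcup (A : nat -> set B) :
  (forall k, l1_approximable (A k)) -> l1_approximable (\bigcup_k A k).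
Proof.
move=> apA; have mA k : measurable (A k) by have [] := apA k.
have mAU : measurable (\bigcup_k A k) by exact: bigcupT_measurable.
split => // e e0; have e20 : 0 < e / 2 by rewrite divr_gt0.
have apU k : l1_approximable (\big[setU/set0]_(i < k) A i).
  elim: k => [|k IH]; first by rewrite big_ord0; exact: l1_approximable0.
  by rewrite big_ord_recr; exact: l1_approximableU.
have [|||||k hk] := @l1dist_cvg0
    (fun k => \1_(\big[setU/set0]_(i < k) A i)) \1_(\bigcup_k A k)
    _ _ _ _ _ _ e20 => //.
- by move=> k; apply: measurable_indic; have [] := apU k.
- by move=> k; exact: unit_valued_indic.
- exact: unit_valued_indic.
- move=> x; rewrite indicE; have [/set_mem[i _ Aix]|xA] := boolP (x \in _).
    apply: cvg_near_cst; near=> k; rewrite indicE mem_set//.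
    rewrite -bigcup_mkord; exists i => //=; near: k; exact: nbhs_infty_gt.
  apply: cvg_near_cst; apply: nearW => k; rewrite indicE memNset//.
  rewrite -bigcup_mkord => -[i _ Aix]; move: xA => /negP; apply.
  by apply/mem_set; exists i.
have [mUk /(_ _ e20)[h [ch h01 hUk]]] := apU k; exists h; split => //.
rewrite [leRHS]splitr; apply: le_trans (lerD hUk hk); apply: l1dist_sub => //.
- exact: continuous_measurable_funRn.
- exact: continuous_measurable_funRn.
- exact: unit_valued_indic.
- exact: unit_valued_indic.
- exact: unit_valued_indic.
- exact: unit_valued_indic.
- by move=> x; rewrite (le_trans _ (ler_normD _ _))// addrA subrK.
Unshelve. all: by end_near. Qed.

(** The approximable sets form a sigma-algebra containing the open sets. *)
Lemma borel_l1_approximable (A : set B) : measurable A -> l1_approximable A.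
Proof.
move=> mA; suff : <<s @open E >> `<=` l1_approximable by apply.
apply: smallest_sub; last by move=> U; exact: l1_approximable_open.
split; first exact: l1_approximable0.
- by move=> U /l1_approximableC; rewrite setTD.
- exact: l1_approximable_bigcup.
Qed.

(** An approximant [f] of [A] is multiplied by an inner approximant [h k] of [U], so the product
    vanishes off [U]. Since the indicators of [A] and [U] multiply to that of [A], the error splits
    into one term for each factor. *)
Lemma borel_approx_inside (A : set B) (U : set E) (e : R) : measurable A ->
  open U -> A `<=` U -> 0 < e -> exists h : E -> R,
  [/\ continuous h, unit_valued h, (forall x, ~ U x -> h x = 0) &
    l1dist h \1_A <= e].
Proof.
move=> mA oU AU e0; have e20 : 0 < e / 2 by rewrite divr_gt0.
have mU := open_measurableRn oU.
have [_ /(_ _ e20)[f [cf f01 hf]]] := borel_l1_approximable mA.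
have mf := continuous_measurable_funRn cf.
have [h [ch h01 h0 hU]] := urysohn_inner oU.
have mh k := continuous_measurable_funRn (ch k).
have [|||||k hk] := @l1dist_cvg0 h \1_U _ _ _ _ _ _ e20 => //.
- exact: unit_valued_indic.
have fh01 : unit_valued (fun x => f x * h k x).
  move=> x; have /andP[? ?] := f01 x; have /andP[? ?] := h01 k x.
  by rewrite mulr_ge0//= mulr_ile1.
exists (fun x => f x * h k x); split => //.
- by move=> x; apply: (@continuousM R E f (h k)); [exact: cf|exact: ch].
- by move=> x /h0 ->; rewrite mulr0.
rewrite [leRHS]splitr; apply: le_trans (lerD hf hk); apply: l1dist_sub => //.
- exact: measurable_funM.
- exact: unit_valued_indic.
- exact: unit_valued_indic.
- exact: unit_valued_indic.
move=> x; have /andP[? ?] := f01 x; have /andP[? ?] := h01 k x.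
have AU1 : \1_A x * \1_U x = \1_A x :> R.
  by rewrite !indicE; have [/set_mem/AU/mem_set ->|] := boolP (x \in A);
    rewrite ?mulr1 ?mul0r.
have -> : f x * h k x - \1_A x =
    (f x - \1_A x) * h k x + \1_A x * (h k x - \1_U x).
  by rewrite mulrBr AU1; ring.
rewrite (le_trans (ler_normD _ _))// !normrM; apply: lerD.
  by rewrite ler_piMr// ger0_norm.
by rewrite ler_piMl// indicE; case: (_ \in _); rewrite ?normr1 ?normr0.
Qed.

End approx.

(** * Elementary inequalities: layer cake sums and tails *)

Section layer_cake.
Context {R : realType}.
Implicit Types e v : R.

(** A non-negative [v] has at most v/e + 1 multiples of [e] in [0, v]; the extra [e] pays for the
    threshold 0. *)
Lemma sum_threshold_le e v m : 0 < e ->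
  e * \sum_(k < m) ((k%:R * e <= v)%R : nat)%:R <= Num.max v 0 + e.
Proof.
move=> e0; elim: m => [|m IH].
  by rewrite big_ord0 mulr0 addr_ge0 ?(ltW e0)// le_max lexx orbT.
rewrite big_ord_recr/=; case: (leP (m%:R * e) v) => [mv|_] /=; last by rewrite mulr0n addr0.
rewrite (@le_trans _ _ (e * m.+1%:R))//.
  rewrite ler_pM2l// mulr1n -(@natr1 _ m) lerD2r//.
  apply: (@le_trans _ _ (\sum_(k < m) 1)); last by rewrite sumr_const card_ord.
  by apply: ler_sum => i _; rewrite lern1 leq_b1.
by rewrite -(@natr1 _ m) mulrDr mulr1 lerD2r le_max mulrC mv.
Qed.

(** Thresholds start at [e] here and at 0 in [sum_threshold_le]. This offset of one step matches the
    loss [eta = e] incurred when passing from a level of [g] to a level of [v j]. The bound on [v]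
    ensures that no threshold is missed. *)
Lemma sum_threshold_ge e v m : 0 < e -> v < m.+1%:R * e ->
  v - e <= e * \sum_(k < m) ((k.+1%:R * e <= v)%R : nat)%:R.
Proof.
move=> e0; elim: m => [|m IH] vm.
  by rewrite big_ord0 mulr0 subr_le0; apply: ltW; rewrite mul1r in vm.
rewrite big_ord_recr/=; case: (leP (m.+1%:R * e) v) => [mv|vm'] /=; last by rewrite mulr0n addr0 IH.
have -> : \sum_(k < m) ((k.+1%:R * e <= v)%R : nat)%:R = m%:R :> R.
  transitivity (\sum_(k < m) (1 : R)); last by rewrite sumr_const card_ord.
  apply: eq_bigr => i _; rewrite (le_trans _ mv)// ler_pM2r// ler_nat.
  by rewrite ltnS ltnW.
rewrite mulr1n natr1 lerBlDr mulrC; apply: ltW; apply: lt_le_trans vm _.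
by rewrite -[X in X * e]natr1 mulrDl mul1r.
Qed.

(** Beyond [N], a = a^p a^(1-p) and the exponent 1 - p is negative, so the last factor is at most
    N^(1-p). *)
Lemma le_add_powR (p N a : R) : 1 < p -> 0 < N -> 0 <= a ->
  a <= N + a `^ p * N `^ (1 - p).
Proof.
move=> p1 N0 a0; have [aN|Na] := leP a N.
  by rewrite (le_trans aN)// lerDl mulr_ge0// powR_ge0.
have a1 : 0 < a by exact: lt_trans Na.
rewrite (@le_trans _ _ (a `^ p * a `^ (1 - p)))//.
  rewrite -powRD; last by apply/implyP => _; rewrite gt_eqF.
  by rewrite addrC subrK powRr1.
rewrite (@le_trans _ _ (a `^ p * N `^ (1 - p)))//; last by rewrite lerDr ltW.
rewrite ler_wpM2l ?powR_ge0//.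
rewrite -[1 - p]opprB !powRN lef_pV2 ?posrE ?powR_gt0//.
by rewrite ge0_ler_powR ?nnegrE ?subr_ge0 ?ltW.
Qed.

End layer_cake.

Lemma Rintegral_sum_ord d (T : measurableType d) (R : realType)
    (mu : {measure set T -> \bar R}) (f : nat -> T -> R) (m : nat) :
  (forall k, mu.-integrable setT (EFin \o f k)) ->
  mu.-integrable setT (EFin \o (fun x => \sum_(k < m) f k x)) /\
  \int[mu]_x (\sum_(k < m) f k x) = \sum_(k < m) \int[mu]_x f k x.
Proof.
move=> fi; elim: m => [|m [IH1 IH2]].
  rewrite big_ord0 /Rintegral; under eq_integral do rewrite big_ord0.
  rewrite integral0; split=> //.
  have := integrable0 mu setT.
  by apply: eq_integrable => // x _ /=; rewrite big_ord0.
split.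
  have := @integrableD _ _ _ mu setT measurableT _ _ IH1 (fi m).
  by apply: eq_integrable => // x _ /=; rewrite big_ord_recr.
rewrite big_ord_recr/= -IH2 -RintegralD//.
by apply: eq_Rintegral => x _; rewrite big_ord_recr.
Qed.

(** * A Fatou inequality for weakly converging densities and strongly converging functions *)

Section weak_strong.
Context {R : realType} {n : nat}.
Local Notation E := 'rV[R]_n.
Local Notation B := (borelRn R n).
Variables (mu : {measure set B -> \bar R}) (phi : B -> R).
Variables (nu : nat -> {measure set B -> \bar R}) (phij : nat -> B -> R) (M : R).
Hypothesis iphi : mu.-integrable setT (EFin \o phi).
Hypothesis nufin : forall j, (nu j setT < +oo)%E.
Hypothesis mphij : forall j, measurable_fun setT (phij j).
Hypothesis phij_bnd : forall j x, 0 <= phij j x <= M.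
Hypothesis weak : forall h : E -> R, continuous h -> unit_valued (h : B -> R) ->
  (fun j => \int[nu j]_x (h x * phij j x)) @ \oo --> \int[mu]_x (h x * phi x).

Let M0 : 0 <= M.
Proof. by have /andP[/le_trans] := phij_bnd 0 point; apply. Qed.

Let iphij j : (nu j).-integrable setT (EFin \o phij j).
Proof.
apply: measurable_bounded_integrable => //; exists M; split; first exact: num_real.
move=> c Mc x _ /=; have /andP[p0 pM] := phij_bnd j x.
by rewrite ger0_norm// (le_trans pM)// ltW.
Qed.

Let iindic (A : set B) : measurable A ->
  mu.-integrable setT (EFin \o (fun x => \1_A x * phi x)).
Proof.
move=> mA; apply: (@integrable_bounded_mul _ _ _ _ iphi 1) => //.
by move=> x; rewrite indicE; case: (_ \in _); rewrite /= ?normr0 ?normr1.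
Qed.

Let iindicj j (A : set B) : measurable A ->
  (nu j).-integrable setT (EFin \o (fun x => \1_A x * phij j x)).
Proof.
move=> mA; apply: (@integrable_bounded_mul _ _ _ _ (iphij j) 1) => //.
by move=> x; rewrite indicE; case: (_ \in _); rewrite /= ?normr0 ?normr1.
Qed.

Let iindic1 j (A : set B) : measurable A ->
  (nu j).-integrable setT (EFin \o \1_A).
Proof.
move=> mA; apply: measurable_bounded_integrable => //.
exists 1; split; first exact: num_real.
move=> c c1 x _ /=; rewrite indicE (le_trans _ (ltW c1))//.
by case: (_ \in _); rewrite /= ?normr0 ?normr1.
Qed.

Let unit_valued_norm (f : B -> R) x : unit_valued f -> `|f x| <= 1.
Proof. by move=> /(_ x)/andP[f0 f1]; rewrite ger0_norm. Qed.

Lemma indic_integral_le_l1dist (A : set B) (h : E -> R) : measurable A ->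
  continuous h -> unit_valued (h : B -> R) ->
  `|\int[mu]_x (h x * phi x) - \int[mu]_x (\1_A x * phi x)| <=
  l1dist mu phi h \1_A.
Proof.
move=> mA ch h01; have mh := continuous_measurable_funRn ch.
have ih : mu.-integrable setT (EFin \o (fun x => h x * phi x)).
  by apply: (@integrable_bounded_mul _ _ _ _ iphi 1) => // x; exact: unit_valued_norm.
rewrite -RintegralB//; last exact: iindic.
apply: le_trans (le_normr_Rintegral _ _) _ => //.
  have := @integrableB _ _ _ mu setT measurableT _ _ ih (iindic mA).
  by apply: eq_integrable.
rewrite /l1dist; rewrite le_eqVlt; apply/orP; left; apply/eqP; apply: eq_Rintegral => x _.
by rewrite -normrM mulrBl.
Qed.

(** Against a non-negative continuous function, the integral of [phi] is a limit of non-negative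
    numbers; L^1 approximation passes this on to indicators. *)
Lemma weak_limit_indic_ge0 (A : set B) : measurable A ->
  0 <= \int[mu]_x (\1_A x * phi x).
Proof.
move=> mA; apply/ler_addgt0Pr => e e0.
have [h [ch h01 _ hA]] := borel_approx_inside iphi mA openT (@subsetT _ _) e0.
have hle := le_trans (indic_integral_le_l1dist mA ch h01) hA.
have : 0 <= \int[mu]_x (h x * phi x).
  rewrite -(cvg_lim _ (weak ch h01))//.
  apply: limr_ge; first by apply/cvg_ex; eexists; exact: weak.
  apply: nearW => j; apply: Rintegral_ge0 => x _.
  by have /andP[? _] := h01 x; have /andP[? _] := phij_bnd j x; exact: mulr_ge0.
by move: hle; rewrite ler_norml => /andP[_]; lra.
Qed.

(** Tested on the set where [phi] is negative, the preceding inequality forces the integral of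
    [|phi|] over that set to vanish. *)
Lemma weak_limit_ae_ge0 : exists N : set B, [/\ measurable N, mu N = 0%E &
  forall x, ~ N x -> 0 <= phi x].
Proof.
have mphi : measurable_fun setT phi.
  by apply/measurable_EFinP; exact: measurable_int iphi.
pose A := [set x : B | phi x < 0].
have mA : measurable A.
  rewrite (_ : A = phi @^-1` `]-oo, 0[%classic).
    by rewrite -[_ @^-1` _]setTI; exact: mphi.
  by apply/seteqP; split => x; rewrite /A /= in_itv.
have iA := iindic mA.
have A0 : (\int[mu]_x `|(\1_A x * phi x)%:E| = 0)%E.
  have i0 : 0 <= \int[mu]_x (- 1 * (\1_A x * phi x)).
    apply: Rintegral_ge0 => x _; rewrite indicE.
    case: (boolP (x \in A)) => [/set_mem|_] /=; last by rewrite mul0r mulr0.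
    by rewrite /A /=; lra.
  have i1 := weak_limit_indic_ge0 mA.
  move: i0; rewrite RintegralZl// mulN1r oppr_ge0 => i0.
  have {i0 i1} i0 : \int[mu]_x (\1_A x * phi x) = 0.
    by apply/eqP; rewrite eq_le i0 i1.
  have : \int[mu]_x (- 1 * (\1_A x * phi x)) = 0 by rewrite RintegralZl// i0 mulr0.
  rewrite /Rintegral => /eqP; rewrite fine_eq0; last first.
    apply: integrable_fin_num => //.
    have := integrableZl measurableT (- 1) iA.
    by apply: eq_integrable.
  move=> /eqP <-; apply: eq_integral => x _ /=; congr EFin.
  rewrite indicE; case: (boolP (x \in A)) => [/set_mem|_] /=.
    by rewrite /A /= !mul1r => /ltW/ler0_norm ->; rewrite mulN1r.
  by rewrite mul0r mulr0 normr0.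
have mf : measurable_fun setT (fun x => (\1_A x * phi x)%:E) := measurable_int _ iA.
have [N [mN N0 AN]] := (ae_eq_integral_abs mu measurableT mf).1 A0.
exists N; split => // x Nx; rewrite leNgt; apply/negP => px; apply: Nx; apply: AN.
move=> /(_ I) [/eqP]; rewrite indicE mem_set//= mul1r => /eqP p0.
by move: px; rewrite p0 ltxx.
Qed.

(* The half of strong convergence of [v] to [g] that controls [v] from below;
   the other half is the same property of [- v] and [- g]. *)
Definition eventually_above (K : set B) (v : nat -> B -> R) (g : B -> R) :=
  forall a b eta delta : R, a < b -> 0 < eta -> 0 < delta ->
  exists U : set E, [/\ open U, K `&` [set x | a <= g x < b] `<=` U &
    \forall j \near \oo,
      (nu j ([set x | (v j x < a - eta)%R] `&` U) <= delta%:E)%E].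

Variables (K : set B) (v : nat -> B -> R) (g : B -> R).
Hypothesis mK : measurable K.
Hypothesis mv : forall j, measurable_fun setT (v j).
Hypothesis mg : measurable_fun setT g.

Let mlt (f : B -> R) (c : R) : measurable_fun setT f ->
  measurable [set x : B | f x < c].
Proof.
move=> mf; rewrite (_ : mkset _ = f @^-1` `]-oo, c[%classic).
  by rewrite -[_ @^-1` _]setTI; exact: mf.
by apply/seteqP; split => x; rewrite /= in_itv.
Qed.

Let mge (f : B -> R) (c : R) : measurable_fun setT f ->
  measurable [set x : B | c <= f x].
Proof.
move=> mf; rewrite (_ : mkset _ = ~` [set x : B | f x < c]).
  by apply: measurableC; exact: mlt.
apply/seteqP; split => x /=; last by move=> /negP; rewrite -leNgt.
by move=> cf; apply/negP; rewrite -leNgt.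
Qed.

Let msl (a b : R) : measurable (K `&` [set x : B | a <= g x < b]).
Proof.
apply: measurableI => //; rewrite (_ : mkset _ = [set x | a <= g x] `&` [set x | g x < b]).
  by apply: measurableI; [exact: mge|exact: mlt].
by apply/seteqP; split => x /= => [/andP[]//|[-> ->]].
Qed.

(** A continuous [h] close to the indicator of the slice, and zero off [U], transports its mass by
    weak convergence. Wherever [h] is non-zero, either [v j] is at least [a - eta] or the point lies
    in the bad part of [U], whose weighted mass is at most [M] times its measure. *)
Lemma eventually_level_mass (a b eta e : R) : eventually_above K v g ->
  a < b -> 0 < eta -> 0 < e ->
  \forall j \near \oo,
    \int[mu]_x (\1_(K `&` [set x : B | a <= g x < b]) x * phi x) - e <=
    \int[nu j]_x (\1_[set x : B | a - eta <= v j x] x * phij j x).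
Proof.
move=> abv ab eta0 e0; set A := K `&` _.
(* One third of [e] each for the approximation by [h], for weak convergence and for the bad set. The
   last is divided by [M + 1] rather than [M], which may be 0. *)
have e30 : 0 < e / 3 by rewrite divr_gt0.
have M10 : 0 < M + 1 by rewrite ltr_wpDl.
have [U [oU AU Ubad]] := abv a b eta (e / 3 / (M + 1)) ab eta0 (divr_gt0 e30 M10).
have [h [ch h01 h0 hA]] := borel_approx_inside iphi (msl a b) oU AU e30.
have hle := le_trans (indic_integral_le_l1dist (msl a b) ch h01) hA.
have /cvgrPdist_le/(_ _ e30) := weak ch h01.
move: Ubad; apply: filterS2 => j Ubad.
rewrite ler_norml => /andP[_ hj].
set V := [set x : B | a - eta <= v j x].
have mV : measurable V by exact: mge.
pose bad : set B := [set x : B | v j x < a - eta] `&` U.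
have {}Ubad : (nu j bad <= (e / 3 / (M + 1))%:E)%E := Ubad.
have mbad : measurable bad by apply: measurableI; [exact: mlt|exact: open_measurableRn].
have mh := continuous_measurable_funRn ch.
have ibad : (nu j).-integrable setT (EFin \o (fun x => M * \1_bad x)).
  have := integrableZl measurableT M (iindic1 j mbad).
  by apply: eq_integrable.
have ih : (nu j).-integrable setT (EFin \o (fun x => h x * phij j x)).
  by apply: (@integrable_bounded_mul _ _ _ _ (iphij j) 1) => // x; exact: unit_valued_norm.
have : \int[nu j]_x (h x * phij j x) <=
    \int[nu j]_x (\1_V x * phij j x) + \int[nu j]_x (M * \1_bad x).
  rewrite -RintegralD//; last exact: iindicj.
  apply: le_Rintegral => //.
    have := @integrableD _ _ _ (nu j) setT measurableT _ _ (iindicj j mV) ibad.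
    by apply: eq_integrable.
  move=> x _; have /andP[p0 pM] := phij_bnd j x; have /andP[hx0 hx1] := h01 x.
  have [Ux|Ux] := pselect (U x); last first.
    by rewrite h0// mul0r addr_ge0// mulr_ge0// indicE.
  rewrite !indicE; have [Vx|/negP Vx] := boolP (x \in V).
    by rewrite mul1r ler_wpDr ?mulr_ge0// ler_piMl.
  rewrite mem_set ?mul0r ?add0r ?mulr1 ?(le_trans _ pM) ?ler_piMl//.
  by split => //=; rewrite ltNge; apply/negP => vx; apply: Vx; exact/mem_set.
have : \int[nu j]_x (M * \1_bad x) <= e / 3.
  rewrite RintegralZl//; last exact: iindic1.
  rewrite /Rintegral integral_indic// setIT.
  apply: (@le_trans _ _ (M * (e / 3 / (M + 1)))).
    rewrite ler_wpM2l// -lee_fin fineK// ge0_fin_numE//.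
    by apply: le_lt_trans Ubad _; rewrite ltry.
  by rewrite mulrCA ler_piMr ?(ltW e30)// ler_pdivrMr// mul1r; lra.
by move: hle; rewrite ler_norml => /andP[? ?]; lra.
Qed.

Hypothesis phi0 : forall x, 0 <= phi x.
Hypothesis phiK : forall x, ~ K x -> phi x = 0.

Let mphi : measurable_fun setT phi.
Proof. by apply/measurable_EFinP; exact: measurable_int iphi. Qed.

Let mgp : measurable_fun setT (fun x => Num.max (g x) 0).
Proof. exact: measurable_maxr. Qed.

(* Layer cake: [g] is compared with the step function of mesh [e = L / (m + 1)]
   whose steps are the sets [A k], to which [eventually_level_mass] applies. *)
Lemma truncated_weak_strong_fatou (C L : R) (m : nat) :
  eventually_above K v g ->
  (\forall j \near \oo,
    (\int[nu j]_x (Num.max (v j x) 0 * phij j x)%:E <= C%:E)%E) ->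
  0 < L ->
  \int[mu]_x ((\1_[set x : B | g x < L] x * Num.max (g x) 0) * phi x) <=
  C + L / m.+1%:R * (2 * \int[mu]_x phi x + 2).
Proof.
move=> abv Cv L0; set e := L / m.+1%:R.
have m0 : 0 < m.+1%:R :> R by rewrite ltr0n.
have e0 : 0 < e by rewrite divr_gt0.
have Le : L = m.+1%:R * e by rewrite /e mulrCA divff ?mulr1// gt_eqF.
pose A (k : nat) := K `&` [set x : B | k.+1%:R * e <= g x < L].
pose V j (k : nat) := [set x : B | k%:R * e <= v j x].
have mV j k : measurable (V j k) by exact: mge.
have [iF intF] := Rintegral_sum_ord m (fun k => iindic (msl (k.+1%:R * e) L)).
(* All slices have the upper end [L], and [eta = e] lowers the threshold from (k+1)e to ke. Each of
   the [m] slices may lose 1/(m+1), hence less than 1 in total. *)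
have S2 : \forall j \near \oo, forall k : 'I_m,
    \int[mu]_x (\1_(A k) x * phi x) - m.+1%:R^-1 <=
    \int[nu j]_x (\1_(V j k) x * phij j x).
  apply: filter_forall => k.
  have ke : k.+1%:R * e < L by rewrite Le ltr_pM2r// ltr_nat ltnS.
  have m10 : 0 < m.+1%:R^-1 :> R by rewrite invr_gt0.
  have := eventually_level_mass abv ke e0 m10; apply: filterS => j.
  by rewrite (_ : k.+1%:R * e - e = k%:R * e)// -natr1 mulrDl mul1r addrK.
have S3 : \forall j \near \oo, \int[nu j]_x phij j x <= \int[mu]_x phi x + 1.
  have c1 : continuous (fun _ : E => 1 : R) by exact: cst_continuous.
  have u1 : unit_valued (fun _ : B => 1 : R) by move=> x; rewrite ler01 lexx.
  have /cvgrPdist_le/(_ _ ltr01) := weak c1 u1; apply: filterS => j.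
  have -> : \int[mu]_x (1 * phi x) = \int[mu]_x phi x.
    by apply: eq_Rintegral => x _; rewrite mul1r.
  have -> : \int[nu j]_x (1 * phij j x) = \int[nu j]_x phij j x.
    by apply: eq_Rintegral => x _; rewrite mul1r.
  by rewrite ler_norml => /andP[? _]; lra.
(* Only finitely many eventual conditions are involved and the conclusion does not mention [j], so a
   single index suffices. *)
have [j [[Cj S2j] S3j]] := filter_ex (filterI (filterI Cv S2) S3).
have [iG intG] := Rintegral_sum_ord m (fun k => iindicj j (mV j k)).
have eG : e * \int[nu j]_x (\sum_(k < m) (\1_(V j k) x * phij j x)) <=
    C + e * (\int[mu]_x phi x + 1).
  have ivp : (nu j).-integrable setT (EFin \o (fun x => Num.max (v j x) 0 * phij j x)).
    apply/integrableP; split.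
      by apply/measurable_EFinP; apply: measurable_funM => //; exact: measurable_maxr.
    apply: le_lt_trans (ltry C); apply: le_trans Cj.
    rewrite le_eqVlt; apply/orP; left; apply/eqP; apply: eq_integral => x _ /=.
    have /andP[? _] := phij_bnd j x.
    by rewrite ger0_norm// mulr_ge0// le_max lexx orbT.
  have iep : (nu j).-integrable setT (EFin \o (fun x => e * phij j x)).
    have := integrableZl measurableT e (iphij j).
    by apply: eq_integrable.
  apply: (@le_trans _ _ (\int[nu j]_x (Num.max (v j x) 0 * phij j x + e * phij j x))).
    rewrite -RintegralZl//; apply: le_Rintegral => //.
    - have := integrableZl measurableT e iG.
      by apply: eq_integrable.
    - have := @integrableD _ _ _ (nu j) setT measurableT _ _ ivp iep.
      by apply: eq_integrable.
    - move=> x _; have /andP[p0 _] := phij_bnd j x.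
      rewrite -mulr_suml mulrA -mulrDl ler_wpM2r//.
      apply: le_trans (sum_threshold_le (v j x) m e0).
      rewrite ler_pM2l//; apply: ler_sum => k _; rewrite indicE.
      by rewrite (_ : (x \in V j k) = (k%:R * e <= v j x)) ?mem_setE.
  rewrite RintegralD// RintegralZl// lerD//; last by rewrite ler_pM2l.
  by rewrite -lee_fin /Rintegral fineK//; exact: integrable_fin_num.
have S1 : \int[mu]_x ((\1_[set x : B | g x < L] x * Num.max (g x) 0) * phi x) <=
    e * \int[mu]_x (\sum_(k < m) (\1_(A k) x * phi x)) + e * \int[mu]_x phi x.
  have ie1 : mu.-integrable setT (EFin \o (fun x => e * \sum_(k < m) (\1_(A k) x * phi x))).
    have := integrableZl measurableT e iF.
    by apply: eq_integrable.
  have ie2 : mu.-integrable setT (EFin \o (fun x => e * phi x)).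
    have := integrableZl measurableT e iphi.
    by apply: eq_integrable.
  rewrite -!RintegralZl// -RintegralD//; apply: le_Rintegral => //.
  - apply: (@integrable_bounded_mul _ _ _ _ iphi L).
      apply: measurable_funM => //; apply: measurable_indic; exact: mlt.
    move=> x; rewrite indicE; have [/set_mem gL|_] := boolP (x \in _).
      rewrite mul1r ger0_norm; last by rewrite le_max lexx orbT.
      by rewrite ge_max !ltW.
    by rewrite mul0r normr0 ltW.
  - have := @integrableD _ _ _ mu setT measurableT _ _ ie1 ie2.
    by apply: eq_integrable.
  - move=> x _; rewrite -mulr_suml mulrA -mulrDl.
    have [Kx|Kx] := pselect (K x); last by rewrite phiK// !mulr0.
    apply: ler_wpM2r => //.
    have s0 : 0 <= e * (\sum_(i < m) \1_(A i) x) + e.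
      apply: addr_ge0; last exact: ltW.
      apply: mulr_ge0; first exact: ltW.
      by apply: sumr_ge0 => k _; rewrite indicE ler0n.
    rewrite [\1_[set _ | _] x]indicE; have [/set_mem /= gL|_] := boolP (x \in _);
      last by rewrite mul0r.
    rewrite mul1r ge_max s0 andbT -lerBlDr.
    rewrite Le in gL; apply: le_trans (sum_threshold_ge e0 gL) _.
    rewrite ler_pM2l//; apply: ler_sum => k _; rewrite indicE.
    case: (leP (k.+1%:R * e) (g x)) => [kg|_]; last by rewrite ler0n.
    by rewrite mem_set// /A /=; split => //; rewrite kg Le.
have S2s : \sum_(k < m) \int[mu]_x (\1_(A k) x * phi x) <=
    \int[nu j]_x (\sum_(k < m) (\1_(V j k) x * phij j x)) + 1.
  rewrite intG -lerBlDr.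
  apply: (@le_trans _ _ (\sum_(k < m) (\int[mu]_x (\1_(A k) x * phi x) - m.+1%:R^-1))).
    rewrite sumrB lerD2l lerN2 sumr_const card_ord -[leLHS]mulr_natl.
    by rewrite ler_pdivrMr// mul1r ler_nat.
  by apply: ler_sum => k _; exact: S2j.
(* The error adds up from e times the integral of [phi] (discretising [g]), e times that integral
   plus 1 (discretising [v j]), and [e] (losses on the slices). *)
apply: le_trans S1 _; rewrite intF.
have : e * \sum_(k < m) \int[mu]_x (\1_(A k) x * phi x) <=
   e * (\int[nu j]_x (\sum_(k < m) (\1_(V j k) x * phij j x)) + 1).
  by rewrite ler_pM2l.
by move: eG; rewrite !mulrDr !mulr1; lra.
Qed.

(* A Fatou lemma for varying measures: truncating [g] at a level [L] and letting
   [L] grow removes the last error term of [truncated_weak_strong_fatou]. *)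
Lemma weak_strong_fatou (C : R) :
  eventually_above K v g ->
  (\forall j \near \oo,
    (\int[nu j]_x (Num.max (v j x) 0 * phij j x)%:E <= C%:E)%E) ->
  (\int[mu]_x (Num.max (g x) 0 * phi x)%:E <= C%:E)%E.
Proof.
move=> abv Cv.
pose f (k : nat) x := \1_[set x : B | g x < k%:R] x * Num.max (g x) 0 * phi x.
have f0 k x : 0 <= f k x.
  by rewrite !mulr_ge0// ?indicE// le_max lexx orbT.
have mf k : measurable_fun setT (f k).
  apply: measurable_funM => //; apply: measurable_funM => //.
  by apply: measurable_indic; exact: mlt.
have fle k : (\int[mu]_x (f k x)%:E <= C%:E)%E.
  have fk : mu.-integrable setT (EFin \o f k).
    apply: (@integrable_bounded_mul _ _ _ _ iphi k%:R).
      apply: measurable_funM => //; apply: measurable_indic; exact: mlt.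
    move=> x; rewrite indicE; have [/set_mem gL|_] := boolP (x \in _).
      rewrite mul1r ger0_norm; last by rewrite le_max lexx orbT.
      by rewrite ge_max ler0n andbT ltW.
    by rewrite mul0r normr0.
  rewrite -[leLHS]fineK; last exact: integrable_fin_num.
  rewrite lee_fin -[fine _]/(\int[mu]_x f k x).
  (* The truncated inequality asks for a positive level. At level 0 the integrand vanishes, and [C]
     is non-negative because it bounds a non-negative integral. *)
  have [->|k0] := eqVneq k 0%N.
    rewrite (_ : Rintegral _ _ _ = 0).
      have [j Cj] := filter_ex Cv.
      rewrite -lee_fin; apply: le_trans Cj; apply: integral_ge0 => x _.
      have /andP[? _] := phij_bnd j x.
      by rewrite lee_fin mulr_ge0// le_max lexx orbT.
    apply/eqP; rewrite (@eq_Rintegral _ _ _ _ _ (fun=> 0)) ?Rintegral_cst ?mul0r// => x _.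
    rewrite /f indicE; have [/set_mem /= gL|_] := boolP (x \in _).
      by rewrite max_r ?mulr0 ?mul0r// ltW.
    by rewrite !mul0r.
  have kpos : 0 < k%:R :> R by rewrite ltr0n lt0n.
  set c := 2 * \int[mu]_x phi x + 2.
  have c0 : 0 < c.
    by rewrite ltr_wpDl// mulr_ge0//; apply: Rintegral_ge0 => x _.
  apply/ler_addgt0Pr => e e0.
  have [m mP] : exists m : nat, k%:R * c / e <= m.+1%:R.
    exists (Num.bound (k%:R * c / e)); apply: ltW.
    by rewrite (lt_trans (archi_boundP _)) ?ltr_nat// divr_ge0 ?mulr_ge0 ?ltW.
  apply: le_trans (truncated_weak_strong_fatou m abv Cv kpos) _.
  rewrite lerD2l -/c mulrAC ler_pdivrMr ?ltr0n//.
  by rewrite [leRHS]mulrC -ler_pdivrMr.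
have flim x : limn (fun k => (f k x)%:E) = (Num.max (g x) 0 * phi x)%:E.
  apply/cvg_lim => //; apply: cvg_near_cst; near=> k; congr EFin.
  rewrite /f indicE mem_set ?mul1r//=; near: k.
  exists (Num.bound `|g x|) => // k /= gk.
  apply: (le_lt_trans (ler_norm _)); rewrite (lt_le_trans (archi_boundP (normr_ge0 _)))//.
  by rewrite ler_nat.
have nd x : nondecreasing_seq (fun k => (f k x)%:E).
  move=> k l kl; rewrite lee_fin ler_wpM2r// ler_wpM2r//.
    by rewrite le_max lexx orbT.
  rewrite !indicE; have [/set_mem /= gk|_] := boolP (x \in [set x | g x < k%:R]).
    by rewrite mem_set//= (lt_le_trans gk)// ler_nat.
  by rewrite ler0n.
rewrite (eq_integral (fun x => limn (fun k => (f k x)%:E))); last first.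
  by move=> x _; rewrite flim.
rewrite (monotone_convergence mu measurableT (g' := fun k x => (f k x)%:E)).
- apply: lime_le; last exact: nearW.
  apply: ereal_nondecreasing_is_cvgn => k l kl; apply: ge0_le_integral => //.
  + by move=> x _; rewrite lee_fin.
  + exact/measurable_EFinP.
  + exact/measurable_EFinP.
  + by move=> x _; exact: nd.
- by move=> k; exact/measurable_EFinP.
- by move=> k x _; rewrite lee_fin.
- by move=> x _; exact: nd.
Unshelve. all: by end_near. Qed.

End weak_strong.

(** * From the Fatou inequality to the limit, by means of p-th moments *)

Section weak_strong_limit.
Context {R : realType} {n : nat}.
Local Notation E := 'rV[R]_n.
Local Notation B := (borelRn R n).
Variables (mu : {measure set B -> \bar R}) (phi : B -> R).
Variables (nu : nat -> {measure set B -> \bar R}) (phij : nat -> B -> R) (M : R).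
Hypothesis iphi : mu.-integrable setT (EFin \o phi).
Hypothesis nufin : forall j, (nu j setT < +oo)%E.
Hypothesis mphij : forall j, measurable_fun setT (phij j).
Hypothesis phij_bnd : forall j x, 0 <= phij j x <= M.
Hypothesis weak : forall h : E -> R, continuous h -> unit_valued (h : B -> R) ->
  (fun j => \int[nu j]_x (h x * phij j x)) @ \oo --> \int[mu]_x (h x * phi x).
Variable K : set B.
Hypothesis mK : measurable K.
Hypothesis phi0 : forall x, 0 <= phi x.
Hypothesis phiK : forall x, ~ K x -> phi x = 0.
Variables (p Cp : R).
Hypothesis p1 : 1 < p.

Let M0 : 0 <= M.
Proof. by have /andP[/le_trans] := phij_bnd 0 point; apply. Qed.

Let mphi : measurable_fun setT phi.
Proof. by apply/measurable_EFinP; exact: measurable_int iphi. Qed.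

Let iphij j : (nu j).-integrable setT (EFin \o phij j).
Proof.
apply: measurable_bounded_integrable => //; exists M; split; first exact: num_real.
move=> c Mc x _ /=; have /andP[q0 qM] := phij_bnd j x.
by rewrite ger0_norm// (le_trans qM)// ltW.
Qed.

Let mpow (v : nat -> B -> R) j : (forall j, measurable_fun setT (v j)) ->
  measurable_fun setT (fun x => `|v j x| `^ p).
Proof.
by move=> mv; apply: (measurableT_comp (measurable_powR p)); exact: measurableT_comp.
Qed.

Section one_sided.
Variables (v : nat -> B -> R) (g : B -> R) (l : R).
Hypothesis mv : forall j, measurable_fun setT (v j).
Hypothesis mg : measurable_fun setT g.
Hypothesis above : eventually_above nu K v g.
Hypothesis vp : forall j, (\int[nu j]_x (`|v j x| `^ p)%:E <= Cp%:E)%E.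
Hypothesis vl : (fun j => \int[nu j]_x (v j x * phij j x)) @ \oo --> l.

Let ipow j : (nu j).-integrable setT (EFin \o (fun x => `|v j x| `^ p)).
Proof.
apply/integrableP; split; first by apply/measurable_EFinP; exact: mpow.
apply: le_lt_trans (ltry Cp); apply: le_trans (vp j).
rewrite le_eqVlt; apply/orP; left; apply/eqP; apply: eq_integral => x _ /=.
by rewrite ger0_norm// powR_ge0.
Qed.

Let ipowphi j : (nu j).-integrable setT (EFin \o (fun x => `|v j x| `^ p * phij j x)).
Proof.
have pjM x : `|phij j x| <= M by have /andP[q0 qM] := phij_bnd j x; rewrite ger0_norm.
have := integrable_bounded_mul (ipow j) (mphij j) pjM.
by apply: eq_integrable => // x _ /=; rewrite mulrC.
Qed.

Let Zint j c (f : B -> R) : (nu j).-integrable setT (EFin \o f) ->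
  (nu j).-integrable setT (EFin \o (fun x => c * f x)).
Proof.
by move=> fi; have := integrableZl measurableT c fi; apply: eq_integrable.
Qed.

Let Dint j (f1 f2 : B -> R) : (nu j).-integrable setT (EFin \o f1) ->
  (nu j).-integrable setT (EFin \o f2) ->
  (nu j).-integrable setT (EFin \o (fun x => f1 x + f2 x)).
Proof.
move=> i1 i2; have := @integrableD _ _ _ (nu j) setT measurableT _ _ i1 i2.
by apply: eq_integrable.
Qed.

Let abs_le_powR N x j : 0 < N -> `|v j x| <= N + N `^ (1 - p) * `|v j x| `^ p.
Proof. by move=> N0; rewrite [X in N + X]mulrC; exact: le_add_powR. Qed.

Lemma integrable_mul_phij j : (nu j).-integrable setT (EFin \o (fun x => v j x * phij j x)).
Proof.
apply: le_integrable (Dint (iphij j) (ipowphi j)) => //.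
  by apply/measurable_EFinP; exact: measurable_funM.
move=> x _ /=; have /andP[q0 _] := phij_bnd j x.
rewrite lee_fin normrM (ger0_norm q0) [leRHS]ger0_norm; last first.
  by rewrite addr_ge0// mulr_ge0// powR_ge0.
rewrite -[X in X + _]mul1r -mulrDl ler_wpM2r//.
by have := abs_le_powR x j ltr01; rewrite powR1 mul1r.
Qed.

(** The Fatou inequality for [v + N], where the bound [C] is the limit of the integrals of [v] and
    [N] against [phij], plus the moment term and a margin [e]. *)
Lemma pos_part_shift_integral_le (N : R) : 0 < N ->
  (\int[mu]_x (Num.max (g x + N) 0 * phi x)%:E <=
   (l + N * \int[mu]_x phi x + M * Cp * N `^ (1 - p))%:E)%E.
Proof.
move=> N0; apply/lee_addgt0Pr => e e0; rewrite -EFinD.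
have mvN j : measurable_fun setT (fun x => v j x + N) by exact: measurable_funD.
have mgN : measurable_fun setT (fun x => g x + N) by exact: measurable_funD.
apply: (weak_strong_fatou (v := fun j x => v j x + N) iphi nufin mphij phij_bnd
  weak mK mvN mgN phi0 phiK).
  move=> a b eta delta ab eta0 delta0.
  have ab' : a - N < b - N by rewrite ltrD2r.
  have [U [oU KU Ubad]] := above ab' eta0 delta0.
  exists U; split => //.
    move=> x [Kx /= /andP[ag gb]]; apply: KU; split => //=.
    by rewrite lerBlDr ag ltrBrDr.
  apply: filterS Ubad => j; rewrite (_ : [set x | _ < a - N - eta] =
    [set x | v j x + N < a - eta])//.
  by apply/seteqP; split => x /=; lra.
(* The convergence to [l] uses [e / 2]; the total mass is later multiplied by [N], so its tolerance
   is [e / 2 / (N + 1)]. *)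
have N1 : 0 < N + 1 by rewrite addr_gt0.
have e20 : 0 < e / 2 by rewrite divr_gt0.
have /cvgrPdist_le/(_ _ e20) V1 := vl.
have c1 : continuous (fun _ : E => 1 : R) by exact: cst_continuous.
have u1 : unit_valued (fun _ : B => 1 : R) by move=> x; rewrite ler01 lexx.
have /cvgrPdist_le/(_ _ (divr_gt0 e20 N1)) := weak c1 u1.
move: V1; apply: filterS2 => j.
have -> : \int[mu]_x (1 * phi x) = \int[mu]_x phi x.
  by apply: eq_Rintegral => x _; rewrite mul1r.
have -> : \int[nu j]_x (1 * phij j x) = \int[nu j]_x phij j x.
  by apply: eq_Rintegral => x _; rewrite mul1r.
rewrite !ler_norml => /andP[V1 _] /andP[V2 _].
have iN := Zint N (iphij j).
have ip := Zint (N `^ (1 - p)) (ipowphi j).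
have isum := Dint (Dint (integrable_mul_phij j) iN) ip.
apply: (@le_trans _ _ (\int[nu j]_x (v j x * phij j x + N * phij j x +
    N `^ (1 - p) * (`|v j x| `^ p * phij j x))%:E)%E).
  apply: ge0_le_integral => //.
  - move=> x _; have /andP[q0 _] := phij_bnd j x.
    by rewrite lee_fin mulr_ge0// le_max lexx orbT.
  - by apply/measurable_EFinP; apply: measurable_funM => //; exact: measurable_maxr.
  - exact: measurable_int isum.
  - move=> x _; have /andP[q0 _] := phij_bnd j x.
    rewrite lee_fin mulrA -!mulrDl ler_wpM2r// ge_max; apply/andP; split.
      by rewrite lerDl mulr_ge0// powR_ge0.
    have := abs_le_powR x j N0; have := ler_norm (- v j x); rewrite normrN; lra.
rewrite -[leLHS]fineK; last exact: integrable_fin_num.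
rewrite lee_fin -[fine _]/(\int[nu j]_x _)%R.
rewrite RintegralD//; last exact: (Dint (integrable_mul_phij j) iN).
rewrite (RintegralD measurableT (integrable_mul_phij j) iN).
rewrite (RintegralZl _ measurableT (iphij j)) (RintegralZl _ measurableT (ipowphi j)).
have P1 : \int[nu j]_x (`|v j x| `^ p * phij j x) <= M * Cp.
  rewrite (@le_trans _ _ (\int[nu j]_x (M * `|v j x| `^ p)))//.
    apply: le_Rintegral => //; first exact: Zint.
    move=> x _; have /andP[q0 qM] := phij_bnd j x.
    by rewrite mulrC ler_wpM2r// powR_ge0.
  rewrite RintegralZl// ler_wpM2l// -lee_fin fineK//; exact: integrable_fin_num.
have P2 : N `^ (1 - p) * \int[nu j]_x (`|v j x| `^ p * phij j x) <=
    M * Cp * N `^ (1 - p) by rewrite mulrC ler_wpM2r// powR_ge0.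
have P3 : N * \int[nu j]_x phij j x <= N * \int[mu]_x phi x + e / 2.
  apply: (@le_trans _ _ (N * (\int[mu]_x phi x + e / 2 / (N + 1)))).
    by rewrite ler_pM2l//; lra.
  rewrite mulrDr lerD2l mulrCA ler_piMr ?(ltW e20)// ler_pdivrMr//; lra.
lra.
Qed.

Let ipos N : 0 < N ->
  mu.-integrable setT (EFin \o (fun x => Num.max (g x + N) 0 * phi x)).
Proof.
move=> N0; apply/integrableP; split.
  apply/measurable_EFinP; apply: measurable_funM => //.
  by apply: measurable_maxr => //; exact: measurable_funD.
apply: le_lt_trans (ltry _); apply: le_trans (pos_part_shift_integral_le N0).
rewrite le_eqVlt; apply/orP; left; apply/eqP; apply: eq_integral => x _ /=.
by rewrite ger0_norm// mulr_ge0// le_max lexx orbT.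
Qed.

(** The positive part of [g] is at most that of [g + 1], so the shifted bound with N = 1 applies. *)
Lemma integrable_pos_part :
  mu.-integrable setT (EFin \o (fun x => Num.max (g x) 0 * phi x)).
Proof.
apply: le_integrable (ipos ltr01) => //.
  by apply/measurable_EFinP; apply: measurable_funM => //; exact: measurable_maxr.
move=> x _ /=; rewrite lee_fin !normrM ler_wpM2r//.
have m0 (y : R) : 0 <= Num.max y 0 by rewrite le_max lexx orbT.
by rewrite !(ger0_norm (m0 _)) ge_max m0 andbT le_max lerDl ler01.
Qed.

(** The contribution N times the integral of [phi] occurs on both sides and cancels, which leaves
    the moment error alone. *)
Lemma integral_le_limit : mu.-integrable setT (EFin \o (fun x => g x * phi x)) ->
  \int[mu]_x (g x * phi x) <= l.
Proof.
move=> ig; apply/ler_addgt0Pr => e e0.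
have MCp0 : 0 <= M * Cp.
  rewrite mulr_ge0// -lee_fin; apply: le_trans (vp 0).
  by apply: integral_ge0 => x _; rewrite lee_fin powR_ge0.
have MCp1 : 0 < M * Cp + 1 by rewrite ltr_wpDl.
have q0 : 0 < e / (M * Cp + 1) by rewrite divr_gt0.
(* Solves N^(1-p) = e / (M Cp + 1), so that the moment error is at most [e]. *)
pose N := (e / (M * Cp + 1)) `^ (1 - p)^-1.
have N0 : 0 < N by exact: powR_gt0.
have Np : N `^ (1 - p) = e / (M * Cp + 1).
  by rewrite -powRrM mulVf ?powRr1 ?(ltW q0)// subr_eq0 lt_eqF.
have iN : mu.-integrable setT (EFin \o (fun x => N * phi x)).
  by have := integrableZl measurableT N iphi; apply: eq_integrable.
have : \int[mu]_x (g x * phi x + N * phi x) <=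
    \int[mu]_x (Num.max (g x + N) 0 * phi x).
  apply: le_Rintegral => //; last 2 first.
  - exact: ipos.
  - by move=> x _; rewrite -mulrDl ler_wpM2r// le_max lexx.
  have := @integrableD _ _ _ mu setT measurableT _ _ ig iN.
  by apply: eq_integrable.
rewrite RintegralD// RintegralZl// => le1.
have : \int[mu]_x (Num.max (g x + N) 0 * phi x) <=
    l + N * \int[mu]_x phi x + M * Cp * N `^ (1 - p).
  rewrite -lee_fin fineK; first exact: pos_part_shift_integral_le.
  exact/integrable_fin_num/ipos.
have : M * Cp * N `^ (1 - p) <= e.
  by rewrite Np mulrCA ler_piMr ?(ltW e0)// ler_pdivrMr// mul1r lerDl.
lra.
Qed.

End one_sided.

Theorem weak_strong_limit (v : nat -> B -> R) (g : B -> R) (l : R) :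
  (forall j, measurable_fun setT (v j)) -> measurable_fun setT g ->
  eventually_above nu K v g ->
  eventually_above nu K (fun j x => - v j x) (fun x => - g x) ->
  (forall j, (\int[nu j]_x (`|v j x| `^ p)%:E <= Cp%:E)%E) ->
  (fun j => \int[nu j]_x (v j x * phij j x)) @ \oo --> l ->
  \int[mu]_x (g x * phi x) = l.
Proof.
move=> mv mg ab1 ab2 vp vl.
have mvN j : measurable_fun setT (fun x => - v j x) by exact: measurable_funN.
have mgN : measurable_fun setT (fun x => - g x) by exact: measurable_funN.
have vpN j : (\int[nu j]_x (`|- v j x| `^ p)%:E <= Cp%:E)%E.
  by under eq_integral do rewrite normrN.
have vlN : (fun j => \int[nu j]_x (- v j x * phij j x)) @ \oo --> - l.
  rewrite (_ : (fun _ => _) = - (fun j => \int[nu j]_x (v j x * phij j x))).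
    exact: cvgN.
  apply/funext => j; rewrite -[RHS]mulN1r -RintegralZl//; last exact: integrable_mul_phij vp j.
  by apply: eq_Rintegral => x _; rewrite mulN1r mulNr.
(* [g] is the difference of the positive parts of [g] and [- g], so integrability of [g phi] comes
   from the two one-sided bounds. *)
have ip := integrable_pos_part mv mg ab1 vp vl.
have iN := integrable_pos_part mvN mgN ab2 vpN vlN.
have ig : mu.-integrable setT (EFin \o (fun x => g x * phi x)).
  have := @integrableB _ _ _ mu setT measurableT _ _ ip iN.
  apply: eq_integrable => // x _; rewrite /= -EFinB -mulrBl; congr (_ * _)%:E.
  by case: (leP (g x) 0) => ?; case: (leP (- g x) 0) => ?; lra.
have igN : mu.-integrable setT (EFin \o (fun x => - g x * phi x)).
  have := integrableZl measurableT (- 1) ig.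
  by apply: eq_integrable => // x _; rewrite /= -EFinM mulN1r mulNr.
apply/eqP; rewrite eq_le (integral_le_limit mv mg ab1 vp vl ig)/=.
have := integral_le_limit mvN mgN ab2 vpN vlN igN.
rewrite (_ : \int[mu]_x (- g x * phi x) = - \int[mu]_x (g x * phi x)) ?lerN2//.
rewrite -[RHS]mulN1r -RintegralZl//.
by apply: eq_Rintegral => x _; rewrite mulN1r mulNr.
Qed.

End weak_strong_limit.

Lemma eq_Rintegral_off_null d (T : measurableType d) (R : realType)
    (m : {measure set T -> \bar R}) (N D1 D2 : set T) (f g : T -> R) :
  measurable N -> m N = 0%E ->
  (forall x, ~ N x -> (f \_ D1) x = (g \_ D2) x) ->
  \int[m]_(x in D1) f x = \int[m]_(x in D2) g x.
Proof.
move=> mN N0 fg; congr fine; apply: (eq_integral_off_null mN N0) => x Nx.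
have eE D (h : T -> R) : ((fun y => (h y)%:E) \_ D) x = ((h \_ D) x)%:E.
  by rewrite -[RHS]/((EFin \o (h \_ D)) x) -restrict_EFin.
by rewrite !eE fg.
Qed.

(** * The support of a Borel measure and the nullity of its complement *)

Section support.
Context {R : realType} {n : nat}.
Local Notation E := 'rV[R]_n.
Local Notation B := (borelRn R n).
Variable m : {measure set B -> \bar R}.

Lemma measurable_ballRn (x : E) (e : R) : 0 < e -> measurable (ball x e : set B).
Proof. by move=> e0; apply: open_measurableRn; exact: ball_open. Qed.

Lemma closed_msupp : closed (msupp m).
Proof.
move=> x clx e e0.
have e20 : 0 < e / 2 by rewrite divr_gt0.
have [y [my xy]] := clx _ (nbhsx_ballx x _ e20).
apply: lt_le_trans (my _ e20) _; apply: le_measure.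
- by rewrite inE; exact: measurable_ballRn.
- by rewrite inE; exact: measurable_ballRn.
- by move=> w yw; rewrite [e]splitr; exact: ball_triangle xy yw.
Qed.

Lemma measurable_msupp : measurable (msupp m : set B).
Proof. by apply: closed_measurableRn; exact: closed_msupp. Qed.

(** Balls of row vectors are products of coordinate intervals, so rational approximation is done
    coordinatewise. *)
Lemma rat_ball (x : E) (e : R) : 0 < e ->
  exists q : 'rV[rat]_n, ball (map_mx ratr q : E) e x.
Proof.
move=> e0.
have /choice[q qP] : forall j : 'I_n, exists q : rat, ball (x ord0 j) e (ratr q).
  move=> j; have [|y [xy [q _ qy]]] := @dense_rat R (ball (x ord0 j) e) _ (ball_open _ _).
    by exists (x ord0 j); exact: ballxx.
  by exists q; rewrite qy.
exists (\row_j q j); split=> // i j; rewrite !mxE ord1; exact: ball_sym.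
Qed.

(* Lindeloef: countably many null balls with rational centres cover the
   complement of the support. *)
Lemma msuppC_null : m (~` msupp m) = 0%E.
Proof.
pose F (i : nat) : set B :=
  if @unpickle ('rV[rat]_n * nat)%type i is Some (q, k) then
    if m (ball (map_mx ratr q : E) k.+1%:R^-1) == 0%E
    then ball (map_mx ratr q : E) k.+1%:R^-1 else set0
  else set0.
have k0 k : 0 < k.+1%:R^-1 :> R by rewrite invr_gt0 ltr0n.
have mF i : measurable (F i).
  rewrite /F; case: unpickle => // -[q k]; case: ifP => // _.
  exact: measurable_ballRn.
have F0 i : m (F i) = 0%E.
  rewrite /F; case: unpickle => [[q k]|]; last exact: measure0.
  by case: ifP => [/eqP//|_]; exact: measure0.
have mU : measurable (\bigcup_i F i) by exact: bigcupT_measurable.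
have msC : measurable (~` msupp m : set B) by apply: measurableC; exact: measurable_msupp.
apply/eqP; rewrite eq_le measure_ge0 andbT.
apply: le_trans (_ : (m (\bigcup_i F i) <= 0)%E); last first.
  apply: le_trans (measure_sigma_subadditive m mF mU (@subset_refl _ _)) _.
  by rewrite eseries0.
apply: le_measure; rewrite ?inE// => x sx.
have [e [e0 me]] : exists e : R, 0 < e /\ m (ball x e) = 0%E.
  apply: contrapT => H; apply: sx => e e0; rewrite lt_neqAle measure_ge0 andbT.
  by apply/negP => /eqP/esym me; apply: H; exists e.
have e20 : 0 < e / 2 by rewrite divr_gt0.
have [k _ /(_ k (leqnn k)) ke] := near_infty_natSinv_lt (PosNum e20).
have [q qx] := rat_ball x (k0 k).
exists (pickle (q, k)) => //; rewrite /F pickleK.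
rewrite ifT//; apply/eqP/le_anti; rewrite measure_ge0 andbT -me.
apply: le_measure.
- by rewrite inE; exact: measurable_ballRn.
- by rewrite inE; exact: measurable_ballRn.
move=> y qy; rewrite [e]splitr; apply: (@ball_triangle _ _ (map_mx ratr q : E)).
  by apply: ball_sym; apply: le_ball qx; exact: ltW.
by apply: le_ball qy; exact: ltW.
Qed.

End support.

Lemma closed_bdry (R : realType) (n : nat) (A : set 'rV[R]_n) : closed (bdry A).
Proof.
rewrite /bdry setDE; apply: closedI; first exact: closed_closure.
by apply: open_closedC; exact: open_interior.
Qed.

Section restrict.
Context {T : Type} {R : realType}.
Implicit Types (f : T -> R) (D : set T).

Lemma restrict_in f D x : D x -> (f \_ D) x = f x.
Proof. by move=> Dx; rewrite patchE mem_set. Qed.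

Lemma restrict_notin f D x : ~ D x -> (f \_ D) x = 0.
Proof. by move=> Dx; rewrite patchE memNset. Qed.

End restrict.

Lemma incr_to_0_near (R : realType) (rj : nat -> R) (V : set R) :
  incr_to_0 rj -> 0^'- V -> \forall j \near \oo, V (rj j).
Proof.
move=> [rj0 _ rjc] V0; have [k _ kP] := rjc _ V0; exists k => // j /kP; apply; exact: rj0.
Qed.

Lemma near_pnorm_bounded (R : realType) (n : nat)
  (mu_r : R -> {measure set borelRn R n -> \bar R}) (S : R -> set 'rV[R]_n)
  (p : R) (u : 'rV[R]_n -> R) : (pnorm mu_r S p u < +oo)%E ->
  exists C : R, \forall r \near 0^'-,
    (\int[mu_r r]_(x in S r) (`|u x| `^ p)%:E <= C%:E)%E.
Proof.
rewrite /pnorm limf_esupE => /ereal_inf_lt[_ [V V0 <-] Voo].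
(* A non-empty [V] makes the supremum non-negative, hence finite. Over an empty [V] it would be
   [-oo], and any constant serves. *)
have [VE|/set0P[r Vr]] := eqVneq V set0.
  by exists 0; apply: filterS V0 => r; rewrite VE.
pose s := ereal_sup [set (\int[mu_r r]_(x in S r) (`|u x| `^ p)%:E)%E | r in V].
have Vs t : V t -> (\int[mu_r t]_(x in S t) (`|u x| `^ p)%:E <= s)%E.
  by move=> Vt; apply: ereal_sup_ubound; exists t.
have s0 : (0 <= s)%E.
  by apply: le_trans (Vs r Vr); apply: integral_ge0 => x _; rewrite lee_fin powR_ge0.
exists (fine s); apply: filterS V0 => t Vt.
by rewrite fineK ?ge0_fin_numE//; exact: Vs.
Qed.

(** * Reduction of the theorem to the limit statement *)

Unset Implicit Arguments.

Theorem theorem5p4 (R : realType) (n : nat) (D : set 'rV[R]_n)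
  (Dr : R -> set 'rV[R]_n)
  (mu_r : R -> {measure set borelRn R n -> \bar R})
  (mu : {measure set borelRn R n -> \bar R})
  (Pr : R -> 'rV[R]_n -> 'rV[R]_n -> R) (P : 'rV[R]_n -> 'rV[R]_n -> R)
  (u us : 'rV[R]_n -> R) (L : R -> 'rV[R]_n -> R) (Lim : 'rV[R]_n -> R)
  (p : R) :
  standing_setting D Dr mu_r mu ->
  (* P_r Borel on D_r x S_r, P Borel on D x bdry D *)
  (forall r, r < 0 ->
     measurable_fun (T := (borelRn R n * borelRn R n)%type)
       (Dr r `*` bdry (Dr r)) (fun zw => Pr r zw.1 zw.2)) ->
  measurable_fun (T := (borelRn R n * borelRn R n)%type)
    (D `*` bdry D) (fun zw => P zw.1 zw.2) ->
  (* non-negative and uniformly bounded for r close to 0 *)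
  (forall z, D z -> exists r0 M : R, r0 < 0 /\
     forall r, r0 < r -> r < 0 -> Dr r z ->
       forall w, bdry (Dr r) w -> 0 <= Pr r z w <= M) ->
  (* P(z, .) is the weak limit values of P_{r_j}(z, .) *)
  (forall z, D z -> exists rj : nat -> R, incr_to_0 rj /\
     weak_limit_values D mu_r mu rj (fun j => Pr (rj j) z) (P z)) ->
  (* u continuous on D *)
  (forall z, D z -> {for z, continuous u}) ->
  (* (1) *)
  (forall r z, r < 0 -> Dr r z ->
     u z = (\int[mu_r r]_(w in bdry (Dr r)) (u w * Pr r z w))%R + L r z) ->
  (* (2) *)
  1 < p -> (pnorm mu_r (fun r => bdry (Dr r)) p u < +oo)%E ->
  (* (3) *)
  has_boundary_values D mu_r mu u us ->
  (forall r z, r < 0 -> Dr r z -> L r z <= 0) ->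
  (forall z, D z -> L ^~ z @ 0^'- --> Lim z) ->
  forall z, D z ->
    u z = (\int[mu]_(w in bdry D) (us w * P z w))%R + Lim z.
Proof.
move=> [[oD _ _] [_ [domDr [Dr_mono [Dr_cup [mu_r_supp [_ [mu_supp _]]]]]]]].
move=> mPr mP Prb weakP cu rep p1 upn [_ bv] _ Llim z Dz.
have [r1 r10 Dr1z] : exists2 r, r < 0 & Dr r z.
  by have := Dz; rewrite -Dr_cup => -[r r0 Drz]; exists r.
have DrD r : r < 0 -> Dr r `<=` D.
  by move=> r0 x Drx; rewrite -Dr_cup; exists r.
pose S r := bdry (Dr r).
have SD r : r < 0 -> S r `<=` D.
  move=> r0 x [clx _].
  (* [r / 2] lies strictly between [r] and 0, so the closure of D_r is contained in D_{r/2}. *)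
  have r20 : r / 2 < 0 by lra.
  have rr2 : r < r / 2 by lra.
  by apply: (DrD (r / 2) r20); have [_] := Dr_mono _ _ rr2 r20; apply.
have mS r : measurable (S r : set (borelRn R n)).
  by apply: closed_measurableRn; exact: closed_bdry.
have mu_rSC r : r < 0 -> mu_r r (~` S r) = 0%E.
  move=> r0; apply/eqP; rewrite eq_le measure_ge0 andbT -(msuppC_null (mu_r r)).
  apply: le_measure; rewrite ?inE.
  - exact: measurableC.
  - by apply: measurableC; exact: measurable_msupp.
  - by apply: subsetC; have [_] := mu_r_supp r r0.
have mu_ru r : r < 0 -> measurable_fun (S r : set (borelRn R n)) u.
  by move=> r0; apply: (measurable_fun_openRn _ oD) => //; exact: SD.
have [rj [rj_incr [[mPz iPz] wP]]] := weakP z Dz.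
(* Boundary values are taken along the very sequence that produces [P z]; [phis] may depend on it
   but equals [us] almost everywhere. *)
have [phis [[[g0 [mg0 phis_g0]] strong] phis_us]] := bv rj rj_incr.
have [r0 [M [r00 PrM]]] := Prb z Dz.
have [Cp Cpb] := near_pnorm_bounded upn.
have mPzb : measurable_fun (bdry D : set (borelRn R n)) (P z).
  have -> : P z = (fun zw => P zw.1 zw.2) \o pair z by [].
  apply: (measurable_comp _ _ mP); last exact: measurable_funTS.
  - apply: measurableX; first exact: open_measurableRn.
    by apply: closed_measurableRn; exact: closed_bdry.
  - by move=> _ [w ww <-].
have mPrz r : r < 0 -> Dr r z ->
    measurable_fun (S r : set (borelRn R n)) (Pr r z).
  move=> rneg Drz; have [oDr _ _] := domDr r rneg.
  have -> : Pr r z = (fun zw => Pr r zw.1 zw.2) \o pair z by [].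
  apply: (measurable_comp _ _ (mPr r rneg)); last exact: measurable_funTS.
  - by apply: measurableX; [exact: open_measurableRn|exact: mS].
  - by move=> _ [w ww <-].
have rj0 j : rj j < 0 by have [] := rj_incr.
have [j0 j0P] : exists j0 : nat, forall j, (j0 <= j)%N -> [/\ r0 < rj j, Dr (rj j) z
    & (\int[mu_r (rj j)]_(x in S (rj j)) (`|u x| `^ p)%:E <= Cp%:E)%E].
  have lt_near c : c < 0 -> \forall j \near \oo, c < rj j.
    move=> c0; exact: (incr_to_0_near rj_incr (nbhs_left_gt c0)).
  have [j0 _ j0P] := filterI (filterI (lt_near _ r00) (lt_near _ r10))
    (incr_to_0_near rj_incr Cpb).
  exists j0 => j /j0P[[? r1rj] ?]; split => //.
  have [_] := Dr_mono r1 (rj j) r1rj (rj0 j); apply; exact: subset_closure.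
(* Passing to a tail makes the bound on P_r, the membership of [z] in D_r and the moment bound valid
   for every index. *)
pose rho j := rj (j + j0)%N.
have rho_neg j : rho j < 0 by exact: rj0.
have rhoP j := j0P (j + j0)%N (leq_addl _ _).
pose nu j := mu_r (rho j).
pose v j : borelRn R n -> R := u \_ (S (rho j)).
pose phij j : borelRn R n -> R := Pr (rho j) z \_ (S (rho j)).
have vE j x : S (rho j) x -> v j x = u x by exact: restrict_in.
have phijE j x : S (rho j) x -> phij j x = Pr (rho j) z x.
  exact: restrict_in.
have phij0 j x : ~ S (rho j) x -> phij j x = 0.
  exact: restrict_notin.
have mv j : measurable_fun setT (v j).
  have [H _] := measurable_restrictT (u : borelRn R n -> R) (mS (rho j)).
  exact: (H (mu_ru _ (rho_neg j))).
have mphij j : measurable_fun setT (phij j).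
  have [_ Dz' _] := rhoP j.
  have [H _] := measurable_restrictT (Pr (rho j) z : borelRn R n -> R) (mS (rho j)).
  exact: (H (mPrz _ (rho_neg j) Dz')).
(* Off the boundary the extension is 0, whereas the sign of [M] is not prescribed. *)
have phij_bnd j x : 0 <= phij j x <= Num.max M 0.
  have [r0rho Dz' _] := rhoP j.
  have [Sx|Sx] := pselect (S (rho j) x); last first.
    by rewrite phij0// lexx le_max lexx orbT.
  have /andP[P0 PM] := PrM _ r0rho (rho_neg j) Dz' _ Sx.
  by rewrite phijE// P0 le_max PM.
have nufin j : (nu j setT < +oo)%E by have [] := mu_r_supp _ (rho_neg j).
pose K0 : set (borelRn R n) := msupp mu.
have mK0 : measurable K0 by exact: measurable_msupp.
have mPz0 : measurable_fun K0 (P z).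
  by apply: measurable_funS mPzb => //; apply: closed_measurableRn; exact: closed_bdry.
pose phi0 : borelRn R n -> R := P z \_ K0.
have mphi0 : measurable_fun setT phi0 
  by have [H _] := measurable_restrictT (P z : borelRn R n -> R) mK0; exact: H.
have phi0E x : K0 x -> phi0 x = P z x by exact: restrict_in.
have phi00 x : ~ K0 x -> phi0 x = 0.
  exact: restrict_notin.
have iphi0 : mu.-integrable setT (EFin \o phi0).
  rewrite /phi0 -restrict_EFin; apply/(integrable_mkcond _ mK0).1.
  by apply/integrableP; split => //; exact/measurable_EFinP.
have SclD j x : S (rho j) x -> closure D x.
  by move=> Sx; apply: subset_closure; exact: SD Sx.
have weak0 (h : 'rV[R]_n -> R) : continuous h -> unit_valued (h : borelRn R n -> R) ->
    (fun j => \int[nu j]_x (h x * phij j x)) @ \oo --> \int[mu]_x (h x * phi0 x).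
  move=> ch _; have := wP h (continuous_subspaceT ch).
  rewrite (_ : \int[mu]_(x in msupp mu) _ = \int[mu]_x (h x * phi0 x)); last first.
    apply: (@eq_Rintegral_off_null _ _ _ _ set0) => // x _.
    rewrite [RHS]restrict_in//; have [Kx|Kx] := pselect (K0 x).
      by rewrite restrict_in// phi0E.
    by rewrite restrict_notin// phi00// mulr0.
  move=> /(cvg_comp _ _ (cvg_addnr j0)); apply: cvg_trans.
  apply: near_eq_cvg; apply: nearW => j /=.
  apply: (@eq_Rintegral_off_null _ _ _ _ (~` S (rho j) : set (borelRn R n))).
  - exact: measurableC.
  - exact: mu_rSC.
  - move=> x /contrapT Sx; rewrite restrict_in; last exact: SclD Sx.
    by rewrite restrict_in// phijE.
have [N' [mN' N'0 N'P]] := weak_limit_ae_ge0 iphi0 phij_bnd weak0.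
have [N1 [mN1 N10 N1P]] := phis_g0.
have [N2 [mN2 N20 N2P]] := phis_us.
(* [N'] contains the points where the limit density is negative, [N1] those of the support where
   [phis] differs from the Borel function [g0]. Strong convergence speaks of the level sets of
   [phis] itself, so equality is required at every point of [K]. *)
pose N : set (borelRn R n) := N' `|` N1.
have mN : measurable N by exact: measurableU.
have N0 : mu N = 0%E by exact: null_set_setU.
pose K : set (borelRn R n) := K0 `\` N.
have mK : measurable K by exact: measurableD.
pose phi : borelRn R n -> R := phi0 \_ K.
have phiE x : ~ N x -> phi x = phi0 x.
  move=> Nx; have [Kx|Kx] := pselect (K0 x); first by rewrite /phi restrict_in.
  by rewrite /phi restrict_notin ?phi00// => -[].
have phiK x : ~ K x -> phi x = 0 by exact: restrict_notin.
have phi_ge0 x : 0 <= phi x.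
  have [Kx|Kx] := pselect (K x); last by rewrite phiK.
  by rewrite /phi restrict_in//; apply: N'P => N'x; apply: Kx.2; left.
have iphi : mu.-integrable setT (EFin \o phi).
  rewrite /phi -restrict_EFin; apply/(integrable_mkcond _ mK).1.
  exact: integrableS iphi0.
have weak (h : 'rV[R]_n -> R) : continuous h -> unit_valued (h : borelRn R n -> R) ->
    (fun j => \int[nu j]_x (h x * phij j x)) @ \oo --> \int[mu]_x (h x * phi x).
  move=> ch h01; have := weak0 h ch h01; congr (_ --> _).
  apply: (eq_Rintegral_off_null mN N0) => x Nx.
  by rewrite !restrict_in// phiE.
pose g : borelRn R n -> R := g0 \_ K0.
have mg : measurable_fun setT g.
  by have [H _] := measurable_restrictT g0 mK0; exact: H.
have gE x : K x -> g x = phis x.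
  move=> [K0x Nx]; rewrite /g restrict_in//; apply: contrapT => H.
  by apply: Nx; right; apply: N1P => /= /(_ K0x)/esym.
have suppS j : msupp (nu j) `<=` S (rho j) by have [] := mu_r_supp _ (rho_neg j).
have nu_le j (A A' : set (borelRn R n)) : measurable A -> measurable A' ->
    A `&` msupp (nu j) `<=` A' -> (nu j A <= nu j A')%E.
  move=> mA mA' AA'; have ms := measurable_msupp (nu j).
  have msC : measurable (~` msupp (nu j) : set (borelRn R n)) by exact: measurableC.
  apply: (@le_trans _ _ (nu j (A' `|` ~` msupp (nu j)))).
    apply: le_measure; rewrite ?inE//; first exact: measurableU.
    move=> x Ax; have [sx|sx] := pselect (msupp (nu j) x); last by right.
    by left; exact: AA'.
  apply: le_trans (measureU2 _ mA' msC) _.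
  by rewrite [X in (_ + X)%E](msuppC_null (nu j)) adde0.
have mclD : measurable (closure D : set (borelRn R n)).
  by apply: closed_measurableRn; exact: closed_closure.
have mlt j c : measurable [set x : borelRn R n | v j x < c].
  rewrite (_ : mkset _ = v j @^-1` `]-oo, c[%classic).
    by rewrite -[_ @^-1` _]setTI; exact: mv.
  by apply/seteqP; split => x; rewrite /= in_itv.
have mgt j c : measurable [set x : borelRn R n | c < v j x].
  rewrite (_ : mkset _ = v j @^-1` `]c, +oo[%classic).
    by rewrite -[_ @^-1` _]setTI; exact: mv.
  by apply/seteqP; split => x; rewrite /= in_itv/= andbT.
have mult j c (U : set 'rV[R]_n) : open U -> measurable ([set x : borelRn R n |
    msupp (mu_r (rho j)) x /\ u x < c] `&` (U `&` closure D)).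
  move=> oU; have mU := open_measurableRn oU.
  apply: measurableI; last exact: measurableI.
  rewrite (_ : mkset _ = msupp (nu j) `&` [set x : borelRn R n | v j x < c]).
    by apply: measurableI => //; exact: measurable_msupp.
  by apply/seteqP; split => x /= [sx]; rewrite vE//; exact: suppS.
have mugt j c (U : set 'rV[R]_n) : open U -> measurable ([set x : borelRn R n |
    msupp (mu_r (rho j)) x /\ c < u x] `&` (U `&` closure D)).
  move=> oU; have mU := open_measurableRn oU.
  apply: measurableI; last exact: measurableI.
  rewrite (_ : mkset _ = msupp (nu j) `&` [set x : borelRn R n | c < v j x]).
    by apply: measurableI => //; exact: measurable_msupp.
  by apply/seteqP; split => x /= [sx]; rewrite vE//; exact: suppS.
have above : eventually_above nu K v g.
  move=> a b eta delta ab eta0 delta0.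
  have [j1 [U [oU [KU jU]]]] := strong a b eta delta ab eta0 delta0.
  exists U; split => //.
    by move=> x [Kx /= abx]; have [] := KU x;
      first by rewrite /= -gE//; split => //; exact: Kx.1.
  exists j1 => // j /= j1j.
  have := jU (j + j0)%N (leq_trans j1j (leq_addr _ _)).
  move=> /ltW; apply: le_trans; apply: le_trans (leeDl _ _) => //.
  apply: nu_le; [|exact: mult|].
    by apply: measurableI => //; exact: open_measurableRn.
  move=> x [[/= vx Ux] sx]; have Sx := suppS _ _ sx.
  by split; [split => //; rewrite -(vE j)|split => //; exact: SclD Sx].
have below : eventually_above nu K (fun j x => - v j x) (fun x => - g x).
  move=> a b eta delta ab eta0 delta0.
  (* The condition a <= - g < b reads - b < g <= - a, closed at the wrong end. The slice is enlarged
     to end at - a + eta/2, and strong convergence with eta/2 brings the threshold back to - a +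
     eta. *)
  have ab' : - b < - a + eta / 2 by lra.
  have eta20 : 0 < eta / 2 by lra.
  have [j1 [U [oU [KU jU]]]] := strong _ _ _ delta ab' eta20 delta0.
  exists U; split => //.
    move=> x [Kx /= /andP[ax bx]]; have [] := KU x => //.
    split; first exact: Kx.1.
    by rewrite -gE//; apply/andP; split; lra.
  exists j1 => // j /= j1j.
  have := jU (j + j0)%N (leq_trans j1j (leq_addr _ _)).
  move=> /ltW; apply: le_trans; apply: le_trans (leeDr _ _) => //.
  apply: nu_le; [|exact: mugt|].
    apply: measurableI; last exact: open_measurableRn.
    rewrite (_ : mkset _ = [set x : borelRn R n | - (a - eta) < v j x])//.
    by apply/seteqP; split => x /=; lra.
  move=> x [[/= vx Ux] sx]; have Sx := suppS _ _ sx.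
  split; [split => //|split => //; exact: SclD Sx].
  by rewrite -(vE j)//; lra.
have vp j : (\int[nu j]_x (`|v j x| `^ p)%:E <= Cp%:E)%E.
  have [_ _] := rhoP j; congr (_ <= _)%E.
  apply: (@eq_integral_off_null _ _ _ _ (~` S (rho j) : set (borelRn R n))).
  - exact: measurableC.
  - exact: mu_rSC.
  - by move=> x /contrapT Sx; rewrite !patchE !mem_set// vE.
(* By the representation formula these integrals are exactly u(z) - L_r(z,u) at r = [rho j]. *)
have vl : (fun j => \int[nu j]_x (v j x * phij j x)) @ \oo --> u z - Lim z.
  rewrite (_ : (fun _ => _) = fun j => u z - L (rho j) z).
    apply: (@cvgB R R^o); first exact: cvg_cst.
    have Lrj : (fun j => L (rj j) z) @ \oo --> Lim z.
      by move=> V /(Llim z Dz); exact: incr_to_0_near.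
    exact: (cvg_comp _ _ (cvg_addnr j0) Lrj).
  apply/funext => j; have [_ Drz _] := rhoP j.
  rewrite (rep _ _ (rho_neg j) Drz) addrK.
  apply: (@eq_Rintegral_off_null _ _ _ _ (~` S (rho j) : set (borelRn R n))).
  - exact: measurableC.
  - exact: mu_rSC.
  - by move=> x /contrapT Sx; rewrite !restrict_in// vE// phijE.
have key : \int[mu]_x (g x * phi x) = u z - Lim z.
  exact: (weak_strong_limit iphi nufin mphij phij_bnd weak mK phi_ge0 phiK p1
    mv mg above below vp vl).
suff -> : \int[mu]_(w in bdry D) (us w * P z w) = \int[mu]_x (g x * phi x).
  by rewrite key subrK.
have mK0C : measurable (~` K0) by exact: measurableC.
(* The exceptional points lie off the support of [mu], in [N], or in the null set [N2] covering
   those where [phis] and [us] differ. *)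
apply: (@eq_Rintegral_off_null _ _ _ _ (~` K0 `|` (N `|` N2) : set (borelRn R n))).
- by apply: measurableU => //; exact: measurableU.
- rewrite null_set_setU//; first exact: measurableU.
    exact: msuppC_null.
  exact: null_set_setU.
- move=> x /not_orP[/contrapT K0x /not_orP[Nx N2x]].
  rewrite !restrict_in//; last exact: mu_supp.
  rewrite phiE// phi0E// gE; last by split.
  congr (_ * _); apply: contrapT => H.
  by apply: N2x; apply: N2P => /= /(_ K0x)/esym.
Qed.
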